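(* Let $\Omega\subsetneq\mathbb{R}^n$ be open with $R:=\sup_{x\in\Omega}d(x)<\infty$. For all $u\in C_c^\infty(\Omega)$, all $s\ge n$ and all $\gamma>1$, $$\int_\Omega\frac{|\nabla u|}{d^{s-1}}dx\ \ge\ (s-n)\int_\Omega\frac{|u|}{d^s}dx+\frac{C}{R^{s-n}}\int_\Omega\frac{|u|}{d^n}X^\gamma\Big(\frac dR\Big)dx$$ holds with a constant $C\ge\gamma-1$.
   Context: $d(x):=\operatorname{dist}(x,\mathbb{R}^n\setminus\Omega)$; $X(t):=(1-\log t)^{-1}$ for $t\in(0,1]$. *)

(* Defs.v *)
From HB Require Import structures.
From mathcomp Require Import all_boot all_order all_algebra.
From mathcomp Require Import all_classical all_reals all_analysis.
Set Implicit Arguments. Unset Strict Implicit. Unset Printing Implicit Defensive.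
Import Order.TTheory GRing.Theory Num.Theory.
Import numFieldNormedType.Exports.
Local Open Scope classical_set_scope.
Local Open Scope ring_scope.

Section Defs.
Variable R : realType.

(* Euclidean norm on R^n = 'rV[R]_n (the library norm on 'rV is the max norm) *)
Definition enorm (n : nat) (v : 'rV[R]_n) : R := Num.sqrt (\sum_(i < n) v ord0 i ^+ 2).

Definition dist_compl (n : nat) (Om : set 'rV[R]_n) (x : 'rV[R]_n) : R :=
  inf [set enorm (x - y) | y in ~` Om].

Definition ebasis (n : nat) (i : 'I_n) : 'rV[R]_n := delta_mx ord0 i.

Fixpoint iter_partial (n : nat) (l : seq 'I_n) (f : 'rV[R]_n -> R) : 'rV[R]_n -> R :=
  match l with
  | [::] => f
  | i :: l' => fun x => derive (iter_partial l' f) x (ebasis i)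
  end.

Definition smooth (n : nat) (f : 'rV[R]_n -> R) : Prop :=
  forall l : seq 'I_n,
    continuous (iter_partial l f) /\
    forall (i : 'I_n) (x : 'rV[R]_n), derivable (iter_partial l f) x (ebasis i).

Definition fsupport (n : nat) (f : 'rV[R]_n -> R) : set 'rV[R]_n :=
  closure [set x | f x != 0].

Definition Cc_infty (n : nat) (Om : set 'rV[R]_n) (f : 'rV[R]_n -> R) : Prop :=
  smooth f /\ compact (fsupport f) /\ fsupport f `<=` Om.

Definition grad_norm (n : nat) (f : 'rV[R]_n -> R) (x : 'rV[R]_n) : R :=
  enorm (\row_(i < n) derive f x (ebasis i)).

(* Lebesgue integral on R^n of a nonnegative function, as the iterated
   Lebesgue integral over the coordinates (Tonelli) *)
Fixpoint iint (n : nat) : ('rV[R]_n -> \bar R) -> \bar R :=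
  match n with
  | 0 => fun f => f 0
  | n'.+1 => fun f =>
      (\int[@lebesgue_measure R]_t
         iint (fun v : 'rV[R]_n' => f (row_mx (const_mx t : 'rV[R]_1) v)))%E
  end.

Definition integral_on (n : nat) (Om : set 'rV[R]_n) (g : 'rV[R]_n -> R) : \bar R :=
  iint (fun x => if `[< Om x >] then (g x)%:E else 0%E).

Definition Xfun (t : R) : R := (1 - ln t)^-1.

End Defs.

(* Main.v *)
(** If T is a vector field on Om with |T| <= d^(1-s) and
    - div T >= (s-n) d^(-s) + (gam-1) rad^(n-s) d^(-n) X^gam(d/rad), the inequality
    follows by integrating T against the gradient of |u|. With
    phi(r) = r^(1-s) - rad^(n-s) r^(1-n) X^(gam-1)(r/rad), the field phi(d) grad d has these
    properties formally, since d is locally an infimum of the functions |x - y|, whose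
    Laplacian is (n-1)/|x - y|. To avoid second derivatives of d, replace it by a soft
    minimum: for finitely many points y outside Om and weights w_y proportional to
    exp(-lam |x - y|), put T = sum_y w_y phi(|x - y|) grad |x - y|. By Cauchy-Schwarz the
    derivatives of the weights only decrease div T, so
    div T <= sum_y w_y div(phi(|x - y|) grad |x - y|). Since phi decreases and |x - y| >= d,
    also |T| <= phi(d). When the points form a fine enough net and lam is large, the weights
    concentrate on the y with |x - y| close to d(x), and the constants converge to the sharp
    ones. All integrands are continuous with compact support; the divergence identity is
    obtained from difference quotients and translation invariance of the iterated integral. *)
Require Import Defs.
From HB Require Import structures.
From mathcomp Require Import all_boot all_order all_algebra.
From mathcomp Require Import all_classical all_reals all_analysis.
From mathcomp Require Import measurable_realfun ring lra.
Set Implicit Arguments.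
Unset Strict Implicit.
Unset Printing Implicit Defensive.

Import Order.TTheory GRing.Theory Num.Theory.
Import numFieldNormedType.Exports.
Local Open Scope classical_set_scope.
Local Open Scope ring_scope.

(** * Integrals over the line: integrability, an upper bound, translation invariance *)

Section line.
Context {R : realType}.
Local Notation mu := (@lebesgue_measure R).

Lemma cc_integrable (M : R) (f : R -> R) : continuous f ->
  (forall t, M < `|t| -> f t = 0) -> mu.-integrable setT (EFin \o f).
Proof.
move=> cf f0; have -> : EFin \o f = (EFin \o f) \_ `[- M, M]%classic.
  apply/funext => t; rewrite patchE; case: ifPn => // /negP tM.
  rewrite /= f0// ltNge; apply/negP => tM'; apply: tM.
  by rewrite inE /= in_itv /= -ler_norml.
apply: (iffLR (integrable_mkcond _ _)) => //.
apply: (@continuous_compact_integrable R f); first exact: segment_compact.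
exact: continuous_subspaceT.
Qed.

Lemma cc_integral_le (M e : R) (f : R -> R) : 0 <= M -> 0 <= e -> continuous f ->
  (forall t, M < `|t| -> f t = 0) -> (forall t, f t <= e) ->
  \int[mu]_t f t <= e * (2 * M).
Proof.
move=> M0 e0 cf f0 fe.
have -> : \int[mu]_t f t = \int[mu]_(t in `[- M, M]%classic) f t.
  rewrite [RHS]Rintegral_mkcond; apply: eq_Rintegral => t _; rewrite patchE.
  case: ifPn => // /negP tM.
  rewrite f0// ltNge; apply/negP => tM'; apply: tM.
  by rewrite inE /= in_itv /= -ler_norml.
have -> : e * (2 * M) = \int[mu]_(t in `[- M, M]%classic) e.
  rewrite Rintegral_cst//= lebesgue_measure_itv /= lte_fin.
  case: ltP => [_|]; first by rewrite /= opprK; congr (_ * _); ring.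
  by rewrite /= => MM; have -> : M = 0; [lra|rewrite !mulr0].
apply: le_Rintegral => //.
- by apply: (integrableS _ _ _ (cc_integrable cf f0)).
- apply: (@continuous_compact_integrable R (cst e)); first exact: segment_compact.
  by apply: continuous_subspaceT => x; exact: cvg_cst.
Qed.

(** By uniqueness of Lebesgue measure, it suffices that the pushforward gives half-open intervals
    their length. *)
Lemma lebesgue_measure_shift (h : R) (A : set R) : measurable A ->
  pushforward mu ((fun t => t + h) : _ -> measurableTypeR R) A = mu A.
Proof.
move=> mA; apply/esym/lebesgue_measure_unique => //=.
  apply: continuous_measurable_fun => t; apply: cvgD; [exact: cvg_id|exact: cvg_cst].
move=> _ _ [[a b]] _ <-.
rewrite /pushforward.
have -> : (fun t : R => t + h) @^-1` `]a, b] = `]a - h, b - h]%classic.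
  by apply/seteqP; split => t; rewrite /= !in_itv /= => /andP[? ?]; apply/andP; split; lra.
rewrite !lebesgue_measure_itv/= !lte_fin ltrD2r.
by case: ifP => // _; rewrite -!EFinB; congr EFin; ring.
Qed.

Lemma cc_integral_shift (M h : R) (f : R -> R) : continuous f ->
  (forall t, M < `|t| -> f t = 0) -> \int[mu]_t f (t + h) = \int[mu]_t f t.
Proof.
move=> cf f0; rewrite /Rintegral; congr fine.
have mphi : measurable_fun setT ((fun t : R => t + h) : measurableTypeR R -> measurableTypeR R).
  by apply: continuous_measurable_fun => t; apply: cvgD; [exact: cvg_id|exact: cvg_cst].
have -> : (\int[mu]_t (f t)%:E = \int[pushforward mu ((fun t : R => (t + h)%R) : measurableTypeR R -> measurableTypeR R)]_t (f t)%:E)%E.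
  by apply: eq_measure_integral => //= A mA _; exact/esym/lebesgue_measure_shift.
rewrite [RHS](integral_pushforward mphi (f := EFin \o f)) //.
- by apply/measurable_EFinP; exact: continuous_measurable_fun.
- have cfh : continuous (fun t : R => f (t + h)).
    move=> t; apply: (@continuous_comp _ _ _ (fun t : R => t + h) f); last exact: cf.
    by apply: cvgD; [exact: cvg_id|exact: cvg_cst].
  apply: (cc_integrable (M := M + `|h|) cfh) => t tM; apply: f0.
  by have := ler_normD (t + h) (- h); rewrite addrK normrN; lra.
Qed.
End line.

(** * Iterated integrals of continuous functions supported in a box *)

Section box_integral.
Context {R : realType}.
Local Notation mu := (@lebesgue_measure R).

Lemma continuous_axpy (T : topologicalType) (f g : T -> R) (a : R) :
  continuous f -> continuous g -> continuous (fun x => a * f x + g x).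
Proof.
move=> cf cg x; apply: cvgD; last exact: cg.
by apply: cvgM; [exact: cvg_cst|exact: cf].
Qed.

Lemma rV_cvg (T : Type) (F : set_system T) {FF : Filter F} (n : nat)
    (f : T -> 'rV[R]_n) (l : 'rV[R]_n) :
  (forall j, f x ord0 j @[x --> F] --> l ord0 j) -> f x @[x --> F] --> l.
Proof.
move=> fl A [P Pl PA]; rewrite /nbhs /=.
suff : \forall x \near F, forall j, P ord0 j (f x ord0 j).
  by apply: filterS => x Px; apply: PA => i j; rewrite ord1; exact: Px.
by apply: filter_forall => j; apply: fl; exact: Pl.
Qed.

(** The same matrix as in [iint], so that slices of [iint] and of [box_integral] agree by
    conversion. *)
Definition cons_row (n : nat) (t : R) (v : 'rV[R]_n) : 'rV[R]_n.+1 :=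
  row_mx (const_mx t : 'rV[R]_1) v.

Lemma cons_row0 n t (v : 'rV[R]_n) : cons_row t v ord0 ord0 = t.
Proof.
have tE : (const_mx t : 'rV[R]_1) ord0 ord0 = t by rewrite mxE.
rewrite -[RHS]tE -[RHS](row_mxEl _ v).
by apply: (congr1 (row_mx _ v ord0)); exact/val_inj.
Qed.

Lemma cons_rowS n t (v : 'rV[R]_n) (j : 'I_n) :
  cons_row t v ord0 (lift ord0 j) = v ord0 j.
Proof.
by rewrite -[RHS](row_mxEr (const_mx t : 'rV[R]_1) v); apply: (congr1 (row_mx _ v ord0)); exact/val_inj.
Qed.

Lemma cons_row_cvg n (T : Type) (F : set_system T) {FF : Filter F}
    (f : T -> R) (g : T -> 'rV[R]_n) (t : R) (v : 'rV[R]_n) :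
  f x @[x --> F] --> t -> g x @[x --> F] --> v ->
  cons_row (f x) (g x) @[x --> F] --> cons_row t v.
Proof.
move=> ft gv; apply: rV_cvg => j.
have [j'|] := unliftP ord0 j => ->.
  under eq_fun do rewrite cons_rowS.
  rewrite cons_rowS.
  apply: (@cvg_comp _ _ _ g (fun w : 'rV[R]_n => w ord0 j') _ _ _ gv).
  exact: coord_continuous.
by under eq_fun do rewrite cons_row0; rewrite cons_row0.
Qed.

Definition box_supported (n : nat) (M : R) (f : 'rV[R]_n -> R) :=
  forall (x : 'rV[R]_n) i, M < `|x ord0 i| -> f x = 0.

(** The real-valued counterpart of [iint], which keeps linearity and estimates free of infinities;
    [iint_box_integral] identifies the two for continuous functions supported in a box. *)
Fixpoint box_integral (n : nat) : ('rV[R]_n -> R) -> R :=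
  match n with
  | 0 => fun f => f 0
  | n'.+1 => fun f => \int[mu]_t box_integral (fun v => f (cons_row t v))
  end.

Section slice.
Context {n : nat} {M : R} {f : 'rV[R]_n.+1 -> R}.
Hypothesis (cf : continuous f) (sf : box_supported M f).

Lemma slice_continuous t : continuous (fun v => f (cons_row t v)).
Proof.
move=> v; apply: (@cvg_comp _ _ _ (cons_row t) f); last exact: cf.
by apply: (@cons_row_cvg n _ (nbhs (v : 'rV[R]_n)) _ (fun=> t) id); [exact: cvg_cst|exact: cvg_id].
Qed.

Lemma slice_supported t : box_supported M (fun v => f (cons_row t v)).
Proof. by move=> v i vM; apply: (@sf _ (lift ord0 i)); rewrite cons_rowS. Qed.

Lemma slice0 t : M < `|t| -> forall v, f (cons_row t v) = 0.
Proof. by move=> tM v; apply: (@sf _ ord0); rewrite cons_row0. Qed.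

(** Uniformity in [v] comes from compactness of the box; for [v] outside the box both values
    vanish. *)
Lemma slice_unif (t0 e : R) : 0 < e -> \forall t \near t0,
  forall v, `|f (cons_row t v) - f (cons_row t0 v)| <= e.
Proof.
move=> e0.
have cK : compact [set v : 'rV[R]_n | forall i, `[- M, M]%classic (v ord0 i)].
  by apply: (@rV_compact _ _ (fun=> `[- M, M]%classic)) => i; exact: segment_compact.
have H : \forall t \near t0, [set v : 'rV[R]_n | forall i, `[- M, M]%classic (v ord0 i)] `<=`
   (fun v => `|f (cons_row t v) - f (cons_row t0 v)| <= e).
  apply: (iffLR (compact_near_coveringP _) cK R (nbhs t0) (fun t v => `|f (cons_row t v) - f (cons_row t0 v)| <= e)) => v _.
  have : f (cons_row p.2 p.1) - f (cons_row t0 p.1) @[p --> (v, t0)] --> 0.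
    rewrite -(subrr (f (cons_row t0 v))).
    apply: cvgB.
      apply: (@cvg_comp _ _ _ (fun p => cons_row p.2 p.1) f); last exact: cf.
      by apply: (@cons_row_cvg n _ (nbhs (v, t0)) _ snd fst); [exact: cvg_snd|exact: cvg_fst].
    apply: (@cvg_comp _ _ _ (fun p => cons_row t0 p.1) f); last exact: cf.
    by apply: (@cons_row_cvg n _ (nbhs (v, t0)) _ (fun=> t0) fst); [exact: cvg_cst|exact: cvg_fst].
  move=> /cvgr0Pnorm_le /(_ _ e0).
  by [].
apply: filterS H => t H v.
have [vK|] := pselect (forall i, `[- M, M]%classic (v ord0 i)); first exact: H.
move=> /existsNP[i]; rewrite /= in_itv /= -ler_norml => /negP; rewrite -ltNge => vM.
by rewrite !(slice_supported _ vM) subrr normr0 ltW.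
Qed.
End slice.

(** Induction hypothesis on the dimension: integrating over one more coordinate requires the inner
    integral to be continuous in that coordinate, which follows from linearity and the one-sided
    bound in the lower dimension. *)
Definition integral_linear_bounded (n : nat) (M : R) :=
  (forall (f g : 'rV[R]_n -> R) a, continuous f -> box_supported M f ->
     continuous g -> box_supported M g ->
     box_integral (fun x => a * f x + g x) = a * box_integral f + box_integral g) /\
  (forall (f : 'rV[R]_n -> R) (e : R), 0 <= e -> continuous f -> box_supported M f ->
     (forall x, f x <= e) -> box_integral f <= e * (2 * M) ^+ n).

Lemma slice_integral_continuous_of (n : nat) (M : R) (f : 'rV[R]_n.+1 -> R) : 0 <= M ->
  integral_linear_bounded n M -> continuous f -> box_supported M f ->
  continuous (fun t => box_integral (fun v => f (cons_row t v))).
Proof.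
move=> M0 [IHl IHe] cf sf t0; apply/cvgrPdist_le => /= e e0.
set V := (2 * M) ^+ n; have V0 : 0 <= V by rewrite exprn_ge0// mulr_ge0.
(* [V] is the volume of the box, so slices within [e / (V + 1)] of each other have integrals within
   [e]; the [+ 1] covers [V = 0]. *)
have e1 : 0 < e / (V + 1) by rewrite divr_gt0// ltr_wpDl.
have := slice_unif cf sf t0 e1; apply: filterS => t H.
have key t1 t2 : (forall v, f (cons_row t1 v) - f (cons_row t2 v) <= e / (V + 1)) ->
    box_integral (fun v => f (cons_row t1 v)) - box_integral (fun v => f (cons_row t2 v)) <= e.
  move=> H'.
  have := IHe (fun v => - 1 * f (cons_row t2 v) + f (cons_row t1 v)) (e / (V + 1)) (ltW e1).
  rewrite IHl; [|exact: slice_continuous|exact: slice_supported|exact: slice_continuous|exact: slice_supported].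
  move=> H2; apply: le_trans (_ : e / (V + 1) * V <= e); last first.
    rewrite mulrAC ler_pdivrMr ?ltr_wpDl//; nra.
  rewrite addrC -mulN1r; apply: H2.
  - by apply: continuous_axpy; exact: slice_continuous.
  - by move=> v i vM; rewrite !(slice_supported _ _ vM)// mulr0 addr0.
  - by move=> v; rewrite mulN1r addrC.
rewrite ler_norml; apply/andP; split; last first.
  by apply: key => v; have := H v; rewrite ler_norml => /andP[]; lra.
rewrite lerNl opprB.
by apply: key => v; have := H v; rewrite ler_norml => /andP[].
Qed.

Lemma box_integral0 n : box_integral (fun _ : 'rV[R]_n => 0) = 0.
Proof.
elim: n => [//|n IH] /=.
under eq_Rintegral do rewrite IH.
by rewrite /Rintegral; under eq_integral do rewrite /=; rewrite integral0.
Qed.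

Lemma slice_integral_out (n : nat) (M : R) (f : 'rV[R]_n.+1 -> R) (t : R) : box_supported M f ->
  M < `|t| -> box_integral (fun v => f (cons_row t v)) = 0.
Proof.
move=> sf tM; rewrite -[RHS](box_integral0 n); congr box_integral.
by apply/funext => v; exact: (slice0 sf tM).
Qed.

Lemma box_integral_linear_bounded (n : nat) (M : R) : 0 <= M -> integral_linear_bounded n M.
Proof.
move=> M0; elim: n => [|n IH].
  by split => [//|f e _ _ _ /(_ 0)]; rewrite expr0 mulr1.
have slice_cont f := slice_integral_continuous_of (f := f) M0 IH.
case: IH => IHl IHe.
split=> [f g a cf sf cg sg|f e e0 cf sf fe] /=.
  under eq_Rintegral => t _.
    rewrite IHl; [over|exact: slice_continuous|exact: slice_supported|exact: slice_continuous|exact: slice_supported].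
  have If := cc_integrable (slice_cont f cf sf) (fun t => slice_integral_out sf).
  have Ig := cc_integrable (slice_cont g cg sg) (fun t => slice_integral_out sg).
  rewrite RintegralD//.
    by rewrite RintegralZl.
  by have := integrableZl measurableT a If.
rewrite exprSr mulrA; apply: cc_integral_le => //.
- by rewrite mulr_ge0// exprn_ge0// mulr_ge0.
- exact: slice_cont.
- by move=> t; exact: slice_integral_out.
- move=> t; apply: IHe => //; first exact: slice_continuous.
  exact: slice_supported.
Qed.

Section corollaries.
Context {n : nat} {M : R}.
Hypothesis M0 : 0 <= M.

Lemma slice_integral_continuous (f : 'rV[R]_n.+1 -> R) :
  continuous f -> box_supported M f ->
  continuous (fun t => box_integral (fun v => f (cons_row t v))).
Proof.
by apply: slice_integral_continuous_of => //; exact: box_integral_linear_bounded.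
Qed.

Lemma box_integral_axpy (f g : 'rV[R]_n -> R) a :
  continuous f -> box_supported M f -> continuous g -> box_supported M g ->
  box_integral (fun x => a * f x + g x) = a * box_integral f + box_integral g.
Proof. exact: (box_integral_linear_bounded n M0).1. Qed.

Lemma box_integral_le_cst (f : 'rV[R]_n -> R) (e : R) : 0 <= e ->
  continuous f -> box_supported M f -> (forall x, f x <= e) ->
  box_integral f <= e * (2 * M) ^+ n.
Proof. exact: (box_integral_linear_bounded n M0).2. Qed.

Lemma le_box_integral (f g : 'rV[R]_n -> R) :
  continuous f -> box_supported M f -> continuous g -> box_supported M g ->
  (forall x, f x <= g x) -> box_integral f <= box_integral g.
Proof.
move=> cf sf cg sg fg.
have := @box_integral_le_cst (fun x => -1 * g x + f x) 0 (lexx _).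
rewrite box_integral_axpy// mul0r mulN1r => H.
suff : - box_integral g + box_integral f <= 0 by lra.
apply: H.
- exact: continuous_axpy.
- by move=> x i xM; rewrite (sf _ _ xM) (sg _ _ xM) mulr0 addr0.
- by move=> x; have := fg x; lra.
Qed.
End corollaries.

Lemma iint_box_integral (n : nat) (M : R) (f : 'rV[R]_n -> R) : 0 <= M ->
  continuous f -> box_supported M f ->
  iint (fun x => (f x)%:E) = (box_integral f)%:E.
Proof.
move=> M0; elim: n f => [//|n IH] f cf sf /=.
under eq_integral => t _.
  rewrite (IH (fun v => f (cons_row t v))); [over|exact: slice_continuous|exact: slice_supported].
rewrite /Rintegral fineK//; apply: integrable_fin_num => //.
apply: cc_integrable (slice_integral_continuous M0 cf sf) _ => t.
exact: slice_integral_out sf.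
Qed.

(** A shift in a later coordinate acts inside the outer integral, by induction; a shift in the first
    coordinate is the one-dimensional case applied to the slice integrals. *)
Lemma box_integral_shift (n : nat) (M : R) (f : 'rV[R]_n -> R) (i : 'I_n) (h : R) : 0 <= M ->
  continuous f -> box_supported M f ->
  box_integral (fun x => f (x + h *: ebasis R i)) = box_integral f.
Proof.
move=> M0; elim: n f i => [f []//|n IH] f i cf sf /=.
have [i'|] := unliftP ord0 i => ->.
  apply: eq_Rintegral => t _.
  rewrite -(IH _ i' (slice_continuous cf (t := t)) (slice_supported sf t)).
  congr box_integral; apply/funext => v; congr f; apply/rowP => j.
  rewrite [LHS]mxE; have [j'|] := unliftP ord0 j => ->.
    by rewrite !cons_rowS !mxE /= (inj_eq (@lift_inj _ _)).
  by rewrite !cons_row0 !mxE /= mulr0 addr0.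
rewrite -[RHS](@cc_integral_shift _ M h); last 2 first.
- exact: (slice_integral_continuous M0 cf sf).
- by move=> t; exact: slice_integral_out sf.
apply: eq_Rintegral => t _; congr box_integral; apply/funext => v; congr f.
apply/rowP => j; rewrite [LHS]mxE; have [j'|] := unliftP ord0 j => ->.
  by rewrite !cons_rowS !mxE /= mulr0 addr0.
by rewrite !cons_row0 !mxE eqxx mulr1.
Qed.
End box_integral.

(** * Integrating a flux against the gradient of |u| *)

Section test_functions.
Context {R : realType}.

(** Near a point outside the closed set [K] the product is identically 0, so [f] may be singular off
    [K]. This serves for powers of the distance and for the vector field, which are controlled only
    on [Om]. *)
Lemma continuous_mul_supp (T : topologicalType) (K : set T) (u f : T -> R) :
  closed K -> (forall x, ~ K x -> u x = 0) -> continuous u ->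
  (forall x, K x -> {for x, continuous f}) -> continuous (fun x => u x * f x).
Proof.
move=> cK u0 cu cf x; have [Kx|nKx] := pselect (K x).
  by apply: continuousM; [exact: cu|exact: cf].
have nK : \forall y \near x, ~ K y by apply: open_nbhs_nbhs; split => //; exact: closed_openC.
have E : {near x, (fun=> 0) =1 (fun y => u y * f y)}.
  by apply: filterS nK => y /u0 ->; rewrite mul0r.
rewrite /continuous_at u0// mul0r.
apply: (cvg_trans (near_eq_cvg E)); exact: cvg_cst.
Qed.

Lemma continuous_add (T : topologicalType) (f g : T -> R) :
  continuous f -> continuous g -> continuous (fun x => f x + g x).
Proof. by move=> cf cg x; apply: cvgD; [exact: cf|exact: cg]. Qed.

Lemma continuous_translate (V : normedModType R) (f : V -> R) (a : V) :
  continuous f -> continuous (fun x => f (x + a)).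
Proof.
move=> cf x; apply: (@continuous_comp _ _ _ (fun x => x + a) f); last exact: cf.
by apply: cvgD; [exact: cvg_id|exact: cvg_cst].
Qed.

Lemma continuous_normr (T : topologicalType) (f : T -> R) (x : T) :
  {for x, continuous f} -> {for x, continuous (fun x => `|f x|)}.
Proof. by move=> cf; apply: (continuous_comp cf); exact: norm_continuous. Qed.

(** Both sides have the same difference quotients, so the one-variable mean value theorem and chain
    rule carry over to directional derivatives. *)
Lemma is_derive_line (V : normedModType R) (f : V -> R) (x v : V) (t df : R) :
  is_derive (x + t *: v) v f df <-> is_derive t 1 (fun s : R => f (x + s *: v)) df.
Proof.
have E : (fun h : R => h^-1 *: (f (h *: v + (x + t *: v)) - f (x + t *: v))) =
         (fun h : R => h^-1 *: ((fun s => f (x + s *: v)) (h *: 1 + t) - f (x + t *: v))).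
  apply/funext => h /=; have -> : h *: (1 : R) = h by rewrite -[RHS]mulr1.
  by rewrite scalerDl addrCA.
by split => -[H1 H2]; constructor; rewrite /derivable /derive in H1 H2 *;
  rewrite ?E// -?E//; rewrite -?H2 /= ?E.
Qed.

(** Stated for [x] and [h] jointly, so that compactness can later provide one [h] for all [x] in a
    box. *)
Lemma near_line (n : nat) (x0 v : 'rV[R]_n) (P : set 'rV[R]_n) :
  `|v| <= 1 -> nbhs x0 P ->
  \forall x \near x0 & h \near (0:R)^'+, forall t, 0 <= t <= h -> P (x + t *: v).
Proof.
move=> v1 /nbhs_ballP[r /= r0 rP]; have r2 : 0 < r / 2 by rewrite divr_gt0.
near=> x h => t /andP[t0 th]; apply: rP; rewrite -ball_normE /=.
have xr : `|x0 - x| < r / 2.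
  by near: x; apply/nbhs_ballP; exists (r / 2) => //= y; rewrite -ball_normE.
have hr : h < r / 2 by near: h; exact: nbhs_right_lt.
rewrite opprD addrA; apply: le_lt_trans (ler_normB _ _) _.
rewrite normrZ ger0_norm// (splitr r); apply: ltrD => //.
by apply: le_lt_trans (le_lt_trans th hr); rewrite ler_piMr.
Unshelve. all: by end_near. Qed.

Lemma norm_ebasis (n : nat) (i : 'I_n) : `|ebasis R i| <= 1.
Proof.
rewrite /Num.norm /= mx_normrE; apply/bigmax_leP; split=> // -[a b] _ /=.
by rewrite /ebasis mxE; case: (_ && _); rewrite /= ?mulr1n ?mulr0n ?normr1 ?normr0.
Qed.

Lemma line_mvt (V : normedModType R) (f df : V -> R) (x v : V) (h : R) : 0 < h ->
  (forall t, 0 <= t <= h -> is_derive (x + t *: v) v f (df (x + t *: v))) ->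
  exists2 t, 0 <= t <= h & f (x + h *: v) - f x = h * df (x + t *: v).
Proof.
move=> h0 fdf.
have dl t : t \in `[0, h] -> is_derive t 1 (fun s : R => f (x + s *: v)) (df (x + t *: v)).
  by rewrite in_itv /= => /fdf /is_derive_line.
pose g (s : R) := f (x + s *: v); pose dg (s : R) := df (x + s *: v).
have dg' t : t \in `]0, h[ -> is_derive t 1 g (dg t) by move=> /subset_itv_oo_cc /dl.
have cg : {within `[0, h], continuous g}.
  by apply: derivable_within_continuous => t /dl [].
have [t th] := MVT h0 dg' cg.
rewrite /g /dg scale0r addr0 subr0 mulrC => ->; exists t => //.
by move: th; rewrite in_itv /= => /andP[/ltW -> /ltW ->].
Qed.

Section coordinate.
Context {n : nat} {K Om : set 'rV[R]_n} {M : R} {u du T D : 'rV[R]_n -> R} {i : 'I_n}.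
Hypotheses (cK : closed K) (u0 : forall x, ~ K x -> u x = 0).
Hypotheses (cu : continuous u) (cdu : continuous du).
Hypothesis hu : forall x, is_derive x (ebasis R i) u (du x).
Hypotheses (oOm : open Om) (KOm : K `<=` Om).
Hypothesis cT : forall x, Om x -> {for x, continuous T}.
Hypothesis cD : forall x, Om x -> {for x, continuous D}.
Hypothesis hT : forall x, Om x -> is_derive x (ebasis R i) T (D x).

Let flux x := `|u x| * T x.
Let flux_bound x := `|du x| * `|T x| + `|u x| * D x.

(** Since [|u|] need not be differentiable, only an upper bound for increments is sought: the mean
    value theorem is applied to [u] and [T] separately, at points where all data are close to their
    values at [x0]. *)
Lemma flux_increment_le (x0 : 'rV[R]_n) (e : R) : 0 < e ->
  \forall x \near x0 & h \near (0:R)^'+,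
    flux (x + h *: ebasis R i) - flux x <= h * (flux_bound x + e).
Proof.
move=> e0; have e1 := norm_ebasis i.
have h_gt0 : \forall x \near x0 & h \near (0:R)^'+, (fun=> 0 < h) (x : 'rV[R]_n).
  by near=> x h => /=; near: h; exact: nbhs_right_gt.
have [Kx|nKx] := pselect (K x0); last first.
  have nK : nbhs x0 (~` K) by apply: open_nbhs_nbhs; split => //; exact: closed_openC.
  apply: filterS2 h_gt0 (near_line e1 nK) => -[x h] /= /ltW h0 H.
  have /u0 uh : (~` K) (x + h *: ebasis R i) by apply: H; rewrite h0 lexx.
  have /u0 ux : (~` K) x by have := H 0; rewrite scale0r addr0 lexx h0; apply.
  rewrite /flux /flux_bound uh ux normr0 !mul0r subrr addr0.
  by rewrite mulr_ge0// addr_ge0 ?mulr_ge0// ltW.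
set A := `|du x0| + `|T x0| + `|u x0| + `|D x0|.
have A0 : 0 <= A by rewrite !addr_ge0.
(* The three error terms below add up to at most [2 * (A + 4) * eta]; [eta <= 1] bounds nearby
   absolute values by the one at [x0] plus 1. *)
pose eta := Num.min 1 (e / (2 * (A + 4))).
have A4 : 0 < 2 * (A + 4) by rewrite mulr_gt0// ltr_wpDl.
have eta0 : 0 < eta by rewrite lt_min ltr01 divr_gt0.
have eta1 : eta <= 1 by rewrite ge_min lexx.
have etae : 2 * (A + 4) * eta <= e.
  by rewrite mulrC -ler_pdivlMr// ge_min lexx orbT.
have OmK := KOm Kx.
have near_le (f : 'rV[R]_n -> R) : {for x0, continuous f} -> \forall y \near x0, `|f x0 - f y| <= eta.
  by move=> /cvgrPdist_le; apply.
pose P y := [/\ Om y, `|du x0 - du y| <= eta, `|T x0 - T y| <= eta,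
  `|u x0 - u y| <= eta & `|D x0 - D y| <= eta].
have nP : nbhs x0 P.
  have nOm : \forall y \near x0, Om y by exact: open_nbhs_nbhs.
  have ndu := near_le _ (@cdu x0); have nu := near_le _ (@cu x0).
  have nT := near_le _ (cT OmK); have nD := near_le _ (cD OmK).
  by near=> y; split; near: y.
apply: filterS2 h_gt0 (near_line e1 nP) => -[x h] /= h0 H.
have [t1 /H [_ P1 _ _ _] E1] : exists2 t, 0 <= t <= h &
    u (x + h *: ebasis R i) - u x = h * du (x + t *: ebasis R i).
  by apply: line_mvt => // t _; exact: hu.
have [t2 /H [_ _ _ _ P2] E2] : exists2 t, 0 <= t <= h &
    T (x + h *: ebasis R i) - T x = h * D (x + t *: ebasis R i).
  by apply: line_mvt => // t /H[/hT].
have [_ _ Ph _ _] : P (x + h *: ebasis R i) by apply: H; rewrite lexx ltW.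
have [_ Qdu QT Qu QD] : P x.
  by have := H 0; rewrite scale0r addr0; apply; rewrite lexx ltW.
rewrite /flux /flux_bound.
move: E1 P1 Ph E2 P2.
set u' := u (x + _); set du' := du (x + _); set T' := T (x + _); set D' := D (x + _).
move=> E1 P1 Ph E2 P2.
(* Discrete product rule. The increment of [|u|] is bounded by the absolute increment of [u], whence
   the absolute values of [du] and [T] in [flux_bound]. *)
have -> : `|u'| * T' - `|u x| * T x = (`|u'| - `|u x|) * T' + `|u x| * (T' - T x) by ring.
have B1 : (`|u'| - `|u x|) * T' <= h * (`|du'| * `|T'|).
  apply: le_trans (ler_norm _) _; rewrite normrM mulrA ler_wpM2r//.
  by apply: le_trans (ler_dist_dist _ _) _; rewrite E1 normrM gtr0_norm.
rewrite E2; apply: (le_trans (lerD B1 (lexx _))).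
have -> : `|u x| * (h * D') = h * (`|u x| * D') by ring.
rewrite -mulrDr ler_pM2l//.
have norm_close (a b c : R) : `|a - b| <= eta -> `|a - c| <= eta -> `|b| - `|c| <= 2 * eta.
  rewrite distrC => ab ac.
  have := le_trans (ler_dist_dist _ _) ab; have := le_trans (ler_dist_dist _ _) ac.
  by rewrite !ler_norml => /andP[? ?] /andP[? ?]; lra.
have dle (a b : R) : `|a - b| <= eta -> `|b| <= `|a| + 1.
  rewrite distrC => ab; have := le_trans (ler_dist_dist _ _) ab.
  by rewrite ler_norml => /andP[_ ?]; lra.
have H1 := norm_close _ _ _ P1 Qdu.
have H2 := norm_close _ _ _ Ph QT.
have H3 : D' - D x <= 2 * eta.
  by move: P2 QD; rewrite !ler_norml => /andP[? ?] /andP[? ?]; lra.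
have H4 := dle _ _ Ph; have H5 := dle _ _ Qdu; have H6 := dle _ _ Qu.
have K1 : (`|du'| - `|du x|) * `|T'| <= 2 * eta * (`|T x0| + 1).
  by apply: le_trans (ler_wpM2r _ H1) _ => //; rewrite ler_wpM2l// mulr_ge0// ltW.
have K2 : `|du x| * (`|T'| - `|T x|) <= (`|du x0| + 1) * (2 * eta).
  by apply: le_trans (ler_wpM2l _ H2) _ => //; rewrite ler_wpM2r// mulr_ge0// ltW.
have K3 : `|u x| * (D' - D x) <= (`|u x0| + 1) * (2 * eta).
  by apply: le_trans (ler_wpM2l _ H3) _ => //; rewrite ler_wpM2r// mulr_ge0// ltW.
have D0 := normr_ge0 (D x0).
have K4 : 2 * eta * (`|T x0| + 1) + (`|du x0| + 1) * (2 * eta) + (`|u x0| + 1) * (2 * eta) <= e.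
  by apply: le_trans etae; rewrite /A; nra.
have -> : `|du'| * `|T'| + `|u x| * D' =
  (`|du'| - `|du x|) * `|T'| + `|du x| * (`|T'| - `|T x|) + `|u x| * (D' - D x)
  + (`|du x| * `|T x| + `|u x| * D x) by ring.
lra.
Unshelve. all: by end_near. Qed.

Hypotheses (M0 : 0 <= M) (KM : forall x j, K x -> `|x ord0 j| <= M).

Lemma flux_continuous : continuous flux.
Proof.
apply: (continuous_mul_supp (K := K)) => // [x nKx|x|x Kx]; last exact/cT/KOm.
  by rewrite u0// normr0.
exact/continuous_normr/cu.
Qed.

Lemma du_supp x : ~ K x -> du x = 0.
Proof.
move=> nKx; have [_ <-] := hu x.
have nK : \forall y \near x, ~ K y by apply: open_nbhs_nbhs; split => //; exact: closed_openC.
rewrite (@near_eq_derive _ _ _ u (cst 0)) ?derive_cst//.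
by apply: filterS nK => y /u0.
Qed.

Lemma flux_bound_continuous : continuous flux_bound.
Proof.
apply: continuous_add.
  apply: (continuous_mul_supp (K := K)) => // [y nKy|y|y Ky].
  - by rewrite du_supp// normr0.
  - exact/continuous_normr/cdu.
  - exact/continuous_normr/cT/KOm.
apply: (continuous_mul_supp (K := K)) => // [y nKy|y|y Ky]; last exact/cD/KOm.
- by rewrite u0// normr0.
- exact/continuous_normr/cu.
Qed.

Lemma flux_bound_supp : box_supported M flux_bound.
Proof.
move=> x j xM; have nK : ~ K x by move=> /KM-/(_ j); rewrite leNgt xM.
by rewrite /flux_bound u0// du_supp// !normr0 !mul0r addr0.
Qed.

Lemma flux_supp : box_supported M flux.
Proof.
move=> x j xM; have nK : ~ K x by move=> /KM-/(_ j); rewrite leNgt xM.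
by rewrite /flux u0// normr0 mul0r.
Qed.

(* The translate of the flux has the same integral, so the increments integrate to 0. *)
Lemma flux_bound_integral_ge0 : 0 <= box_integral flux_bound.
Proof.
set e_i := ebasis R i.
(* Translation by [h < 1] moves the support by less than 1, so everything fits into the box of
   half-width [M + 1]. *)
have M1 : 0 <= M + 1 by rewrite addr_ge0.
have le_supp (f : 'rV[R]_n -> R) : box_supported M f -> box_supported (M + 1) f.
  by move=> sf x j xM; apply: (sf x j); apply: lt_trans xM; rewrite ltrDl.
have V0 : 0 <= (2 * (M + 1)) ^+ n by rewrite exprn_ge0// mulr_ge0.
have cflux := flux_continuous; have sflux := flux_supp.
suff main e : 0 < e -> - box_integral flux_bound <= e * (2 * (M + 1)) ^+ n.
  rewrite -oppr_le0; apply/ler_addgt0Pr => e e0.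
  have H0 : 0 < (2 * (M + 1)) ^+ n + 1 by rewrite ltr_wpDl.
  apply: le_trans (main (e / ((2 * (M + 1)) ^+ n + 1)) _) _; first by rewrite divr_gt0.
  by rewrite add0r mulrAC ler_pdivrMr// ler_wpM2l ?ltW// ltrDl.
move=> e0.
have cB : compact [set v : 'rV[R]_n | forall j, `[- (M + 1), M + 1]%classic (v ord0 j)].
  by apply: (@rV_compact _ _ (fun=> `[- (M + 1), M + 1]%classic)) => j; exact: segment_compact.
(* By compactness of the box, one small [h] serves for all its points. *)
have : \forall h \near (0:R)^'+, [set v : 'rV[R]_n | forall j, `[- (M + 1), M + 1]%classic (v ord0 j)] `<=`
    (fun x => flux (x + h *: e_i) - flux x <= h * (flux_bound x + e)).
  apply: (iffLR (compact_near_coveringP _) cB R ((0:R)^'+)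
    (fun h x => flux (x + h *: e_i) - flux x <= h * (flux_bound x + e))) => x _.
  exact: flux_increment_le.
move=> near_h.
have [h [[h0 h1] hK]] : exists h : R, (0 < h /\ h < 1) /\
   [set v : 'rV[R]_n | forall j, `[- (M + 1), M + 1]%classic (v ord0 j)] `<=`
    (fun x => flux (x + h *: e_i) - flux x <= h * (flux_bound x + e)).
  have h1 : \forall h \near (0:R)^'+, 0 < h /\ h < 1.
    by near=> h; split; near: h; [exact: nbhs_right_gt|exact: nbhs_right_lt].
  exact: (@filter_ex _ ((0:R)^'+) _ _ (filterI h1 near_h)).
have cfluxh : continuous (fun x : 'rV[R]_n => flux (x + h *: e_i)) by exact: continuous_translate.
have sfluxh : box_supported (M + 1) (fun x : 'rV[R]_n => flux (x + h *: e_i)).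
  move=> x j xM; apply: (sflux _ j); rewrite !mxE.
  have : `|x ord0 j| <= `|x ord0 j + h * (e_i ord0 j)| + h.
    rewrite -{1}(addrK (h * e_i ord0 j) (x ord0 j)).
    apply: le_trans (ler_normB _ _) _; rewrite lerD2l normrM gtr0_norm// ger_pMr//.
    by rewrite /e_i /ebasis mxE; case: (_ && _); rewrite /= ?mulr1n ?mulr0n ?normr1 ?normr0.
  rewrite /e_i /ebasis mxE; lra.
(* This integrates the difference quotient of the flux minus [flux_bound]; the two flux terms cancel
   by translation invariance. The trailing [+ 0] gives the shape required by [box_integral_axpy]. *)
rewrite -(_ : box_integral (fun x : 'rV[R]_n => h^-1 * flux (x + h *: e_i) +
    (- h^-1 * flux x + (-1 * flux_bound x + 0))) = - box_integral flux_bound); last first.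
  have c0 : continuous (fun _ : 'rV[R]_n => 0 : R) by exact: cst_continuous.
  have s0 : box_supported (M + 1) (fun _ : 'rV[R]_n => 0 : R) by [].
  have cb : continuous (fun x => -1 * flux_bound x + 0).
    by apply: continuous_axpy => //; exact: flux_bound_continuous.
  have sb : box_supported (M + 1) (fun x => -1 * flux_bound x + 0).
    by move=> x j xM; rewrite (le_supp _ flux_bound_supp _ _ xM) mulr0 addr0.
  rewrite (box_integral_axpy M1)//; last 2 first.
  - exact: continuous_axpy.
  - by move=> x j xM; rewrite (sb _ _ xM) (le_supp _ sflux _ _ xM) mulr0 addr0.
  rewrite (box_integral_shift i h M1 cflux (le_supp _ sflux)).
  rewrite (box_integral_axpy M1)//; last exact: le_supp.
  rewrite (box_integral_axpy M1)//; last 2 first.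
  - exact: flux_bound_continuous.
  - exact: (le_supp _ flux_bound_supp).
  by rewrite box_integral0; ring.
apply: box_integral_le_cst => //; first exact: ltW.
- by do 3!apply: continuous_axpy => //; [exact: flux_bound_continuous|exact: cst_continuous].
- move=> x j xM; rewrite (sfluxh _ _ xM) (le_supp _ sflux _ _ xM) (le_supp _ flux_bound_supp _ _ xM).
  by rewrite !mulr0 !addr0.
- move=> x; have [xK|/existsNP[j]] := pselect (forall j, `[- (M + 1), M + 1]%classic (x ord0 j)).
    have := hK _ xK; rewrite /= -ler_pdivrMl//; lra.
  rewrite /= in_itv /= -ler_norml => /negP; rewrite -ltNge => xM.
  rewrite (sfluxh _ _ xM) (le_supp _ sflux _ _ xM) (le_supp _ flux_bound_supp _ _ xM).
  by rewrite !mulr0 !addr0 ltW.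
Unshelve. all: by end_near. Qed.
End coordinate.
End test_functions.

(** * Euclidean norm and distance to the complement *)

Section euclidean.
Context {R : realType}.

Lemma continuous_sum (T : topologicalType) (I : Type) (r : seq I) (f : I -> T -> R) (x : T) :
  (forall i, {for x, continuous (f i)}) ->
  {for x, continuous (fun y => \sum_(i <- r) f i y)}.
Proof.
move=> cf; elim: r => [|i r IH].
  rewrite (_ : (fun y => _) = cst 0); first exact: cst_continuous.
  by apply/funext => y; rewrite big_nil.
rewrite (_ : (fun y => _) = (fun y => f i y + \sum_(i <- r) f i y)).
  exact: (@continuousD _ _ _ (f i) (fun y => \sum_(i <- r) f i y)).
by apply/funext => y; rewrite big_cons.
Qed.

Lemma continuous_of_modulus (T : topologicalType) (f : T -> R) (g : T -> T -> R) :
  (forall x, {for x, continuous (g x)}) -> (forall x, g x x = 0) ->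
  (forall x z, `|f x - f z| <= g x z) -> continuous f.
Proof.
move=> cg g0 fg x; apply/cvgrPdist_le => /= e e0.
have /cvgrPdist_le /(_ _ e0) := cg x; apply: filterS => z /=.
rewrite g0 sub0r normrN => H; apply: le_trans (fg x z) _.
by apply: le_trans H; exact: ler_norm.
Qed.

Lemma cauchy_schwarz (I : finType) (a b : I -> R) :
  \sum_i a i * b i <= Num.sqrt (\sum_i a i ^+ 2) * Num.sqrt (\sum_i b i ^+ 2).
Proof.
have zero (f g : I -> R) : \sum_i f i ^+ 2 = 0 -> \sum_i f i * g i = 0.
  move=> f0; apply: big1 => i _.
  have /eqP := @psumr_eq0P _ _ _ _ (fun i _ => sqr_ge0 (f i)) f0 i isT.
  by rewrite sqrf_eq0 => /eqP ->; rewrite mul0r.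
set A := \sum_i a i ^+ 2; set B := \sum_i b i ^+ 2; set C := \sum_i a i * b i.
have A0 : 0 <= A by apply: sumr_ge0 => i _; exact: sqr_ge0.
have B0 : 0 <= B by apply: sumr_ge0 => i _; exact: sqr_ge0.
have [pq|] := ltP 0 (Num.sqrt A * Num.sqrt B); last first.
  move=> pq; have : Num.sqrt A * Num.sqrt B == 0.
    by rewrite eq_le pq mulr_ge0// sqrtr_ge0.
  rewrite mulf_eq0 !sqrtr_eq0 => /orP[A0'|B0'].
    rewrite /C zero ?mulr_ge0 ?sqrtr_ge0//.
    by apply/eqP; rewrite eq_le A0 A0'.
  rewrite /C; under eq_bigr do rewrite mulrC.
  rewrite zero ?mulr_ge0 ?sqrtr_ge0//.
  by apply/eqP; rewrite eq_le B0 B0'.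
(* With [P = Num.sqrt A * Num.sqrt B], this sum of squares equals [2 * P * (P - C)]; the case
   [P = 0] is settled above, so [P] can be cancelled. *)
have : 0 <= \sum_i (Num.sqrt B * a i - Num.sqrt A * b i) ^+ 2.
  by apply: sumr_ge0 => i _; exact: sqr_ge0.
have -> : \sum_i (Num.sqrt B * a i - Num.sqrt A * b i) ^+ 2 =
    Num.sqrt B ^+ 2 * A - 2 * (Num.sqrt A * Num.sqrt B) * C + Num.sqrt A ^+ 2 * B.
  rewrite /A /B /C !mulr_sumr -sumrB -big_split /=; apply: eq_bigr => i _; ring.
rewrite !sqr_sqrtr// => H.
rewrite -(ler_pM2l pq) -expr2 exprMn !sqr_sqrtr//; lra.
Qed.

(** * The Euclidean norm and its comparison with the max norm *)

Section enorm.
Context {n : nat}.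
Implicit Types v w : 'rV[R]_n.

Lemma enorm_ge0 v : 0 <= enorm v. Proof. exact: sqrtr_ge0. Qed.

Lemma sqr_enorm v : enorm v ^+ 2 = \sum_i v ord0 i ^+ 2.
Proof. by rewrite sqr_sqrtr// sumr_ge0// => i _; exact: sqr_ge0. Qed.

Lemma enormD v w : enorm (v + w) <= enorm v + enorm w.
Proof.
rewrite -(@ler_pXn2r _ 2)// ?nnegrE ?addr_ge0 ?enorm_ge0//.
rewrite sqrrD !sqr_enorm.
have -> : \sum_i (v + w) ord0 i ^+ 2 =
    \sum_i v ord0 i ^+ 2 + (\sum_i v ord0 i * w ord0 i) *+ 2 + \sum_i w ord0 i ^+ 2.
  by rewrite -sumrMnl -!big_split /=; apply: eq_bigr => i _; rewrite mxE; ring.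
rewrite lerD2r lerD2l lerMn2r /=; exact: cauchy_schwarz.
Qed.

Lemma enormN v : enorm (- v) = enorm v.
Proof. by rewrite /enorm; congr Num.sqrt; apply: eq_bigr => i _; rewrite mxE sqrrN. Qed.

Lemma normr_le_enorm v : `|v| <= enorm v.
Proof.
rewrite /Num.norm /= mx_normrE; apply/bigmax_leP; split; first exact: enorm_ge0.
move=> -[a b] _ /=; rewrite ord1 -sqrtr_sqr; apply: ler_wsqrtr.
by rewrite (bigD1 b)//= lerDl; apply: sumr_ge0 => i _; exact: sqr_ge0.
Qed.

Lemma enorm_continuous : continuous (fun v : 'rV[R]_n => enorm v).
Proof.
move=> v; apply: (@continuous_comp _ _ _ (fun v : 'rV[R]_n => \sum_i v ord0 i ^+ 2) Num.sqrt).
  apply: continuous_sum => i; apply: (@continuous_comp _ _ _ (fun v : 'rV[R]_n => v ord0 i) (fun t : R => t ^+ 2)).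
    exact: coord_continuous.
  exact: exprn_continuous.
exact: sqrt_continuous.
Qed.

Lemma enorm_gt0 v : v != 0 -> 0 < enorm v.
Proof. by move=> v0; apply: lt_le_trans (normr_le_enorm v); rewrite normr_gt0. Qed.
End enorm.

(** * The distance to the complement: near-minimizers, Lipschitz continuity, positivity *)

Section distance.
Context {n : nat} {Om : set 'rV[R]_n}.
Hypotheses (oOm : open Om) (Om_proper : Om != setT).
Local Notation d := (dist_compl Om).

Let compl_nonempty : exists y, ~ Om y.
Proof. by apply/existsNP => H; move/eqP: Om_proper; apply; apply/seteqP; split => // x _; exact: H. Qed.

Let dist_has_inf x : has_inf [set enorm (x - y) | y in ~` Om].
Proof.
have [y nOy] := compl_nonempty; split; first by exists (enorm (x - y)), y.
by exists 0 => _ [z _ <-]; exact: enorm_ge0.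
Qed.

Lemma dist_le x y : ~ Om y -> d x <= enorm (x - y).
Proof. by move=> nOy; apply: ge_inf; [exact: (dist_has_inf x).2|exists y]. Qed.

Lemma dist_approx x e : 0 < e -> exists2 y, ~ Om y & enorm (x - y) < d x + e.
Proof. by move=> e0; have [_ [y nOy <-] H] := inf_adherent e0 (dist_has_inf x); exists y. Qed.

Lemma dist_lipschitz x z : d x <= d z + enorm (x - z).
Proof.
apply/ler_addgt0Pr => e e0; have [y nOy zy] := dist_approx z e0.
apply: le_trans (dist_le x nOy) _; rewrite -(subrKA z).
by apply: le_trans (enormD _ _) _; rewrite addrC addrAC lerD2r ltW.
Qed.

Lemma dist_continuous : continuous (fun x => d x).
Proof.
apply: (@continuous_of_modulus ('rV[R]_n : topologicalType) _ (fun x z : 'rV[R]_n => enorm (z - x))) => [x|x|x z].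
- exact: (@continuous_translate _ _ (fun z : 'rV[R]_n => enorm z) (- x) enorm_continuous).
- by rewrite subrr /enorm big1 ?sqrtr0// => i _; rewrite mxE expr0n.
have := dist_lipschitz x z; have := dist_lipschitz z x.
by rewrite -(enormN (x - z)) opprB ler_norml; move=> ? ?; apply/andP; split; lra.
Qed.

Lemma dist_gt0 x : Om x -> 0 < d x.
Proof.
move=> Ox; have /nbhs_ballP[r /= r0 rO] : nbhs x Om by exact: open_nbhs_nbhs.
apply: lt_le_trans r0 _; apply: lb_le_inf; first exact: (dist_has_inf x).1.
move=> _ [y nOy <-]; rewrite leNgt; apply/negP => xy; apply: nOy; apply: rO.
by rewrite -ball_normE /=; apply: le_lt_trans xy; exact: normr_le_enorm.
Qed.
End distance.
End euclidean.

(** * The soft minimum field *)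

Section directional_derivatives.
Context {R : realType} {V : normedModType R}.
Implicit Types (f g : V -> R) (x v : V).

Lemma is_derive_add f g x v (df dg : R) : is_derive x v f df -> is_derive x v g dg ->
  is_derive x v (fun x => f x + g x) (df + dg).
Proof. exact: is_deriveD. Qed.

Lemma is_derive_mul f g x v (df dg : R) : is_derive x v f df -> is_derive x v g dg ->
  is_derive x v (fun x => f x * g x) (f x * dg + g x * df).
Proof. exact: is_deriveM. Qed.

Lemma is_derive_chain (h : R -> R) g x v (dh dg : R) :
  is_derive (g x) 1 h dh -> is_derive x v g dg ->
  is_derive x v (fun x => h (g x)) (dh * dg).
Proof.
have E (f : V -> R) df : is_derive x v f df <-> is_derive (0:R) 1 (fun s : R => f (x + s *: v)) df.
  by rewrite -is_derive_line scale0r addr0.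
move=> hh /E hg; apply/E.
apply: (@is_derive1_comp R h (fun s => g (x + s *: v))) => //.
by rewrite scale0r addr0.
Qed.

Lemma is_derive_big (I : Type) (r : seq I) (f : I -> V -> R) (df : I -> R) x v :
  (forall i, is_derive x v (f i) (df i)) ->
  is_derive x v (fun x => \sum_(i <- r) f i x) (\sum_(i <- r) df i).
Proof.
move=> fdf; elim: r => [|i r IH].
  rewrite big_nil (_ : (fun y => _) = cst 0); first exact: is_derive_cst.
  by apply/funext => y; rewrite big_nil.
rewrite big_cons (_ : (fun y => _) = (fun y => f i y + \sum_(i <- r) f i y)).
  exact: is_derive_add.
by apply/funext => y; rewrite big_cons.
Qed.

Lemma is_derive_inv g x v (dg : R) : g x != 0 -> is_derive x v g dg ->
  is_derive x v (fun x => (g x)^-1) (- (g x) ^- 2 * dg).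
Proof.
move=> g0 hg; apply: (@is_derive_chain GRing.inv) => //.
rewrite -[X in is_derive _ _ _ X]mulr1.
exact: (@is_deriveV _ id).
Qed.
End directional_derivatives.

Section enorm_derivative.
Context {R : realType} {n : nat}.

Lemma is_derive_coord (y x : 'rV[R]_n) (i j : 'I_n) :
  is_derive x (ebasis R i) (fun x : 'rV[R]_n => (x - y) ord0 j) (i == j)%:R.
Proof.
have -> : x = x + 0 *: ebasis R i by rewrite scale0r addr0.
apply/is_derive_line.
have -> : (fun s => (x + s *: ebasis R i - y) ord0 j) =
    (fun s => (x - y) ord0 j + (i == j)%:R * s).
  by apply/funext => s; rewrite !mxE eqxx /= eq_sym; ring.
have H := is_derive_mul (is_derive_cst ((i == j)%:R : R) (0 : R) 1) (is_derive_id (0:R) 1).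
apply: is_derive_eq (is_derive_add (is_derive_cst ((x - y) ord0 j : R) (0 : R) 1) H) _.
by rewrite add0r mulr1 mulr0 addr0.
Qed.

Lemma is_derive_enorm (y x : 'rV[R]_n) (i : 'I_n) : x != y ->
  is_derive x (ebasis R i) (fun x : 'rV[R]_n => enorm (x - y))
    ((x - y) ord0 i / enorm (x - y)).
Proof.
move=> xy; have r0 : 0 < enorm (x - y) by rewrite enorm_gt0 ?subr_eq0.
have H : is_derive x (ebasis R i) (fun x : 'rV[R]_n => \sum_j (x - y) ord0 j ^+ 2)
    (2 * (x - y) ord0 i).
  have H j := is_derive_mul (is_derive_coord y x i j) (is_derive_coord y x i j).
  apply: is_derive_eq (is_derive_big _ H) _.
  rewrite (bigD1 i)//= big1 => [|j ji]; first by rewrite eqxx addr0 mulr1 mulr2n mulrDl mul1r.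
  by rewrite eq_sym (negbTE ji) !mulr0 addr0.
apply: is_derive_eq (@is_derive_chain _ _ Num.sqrt _ _ _ _ _ _ H) _.
  by apply: is_derive1_sqrt; rewrite -sqr_enorm exprn_gt0.
rewrite -/(enorm (x - y)); field; exact: lt0r_neq0.
Qed.
End enorm_derivative.

(** * The exponentially weighted field: derivatives, length and divergence *)

Section softmin_field.
Context {R : realType} {n : nat}.
Variables (Y : seq 'rV[R]_n) (lam : R) (q dq : R -> R).
Hypothesis lam0 : 0 <= lam.
Hypothesis q0 : forall r : R, 0 < r -> 0 <= q r.
Hypothesis hq : forall r : R, 0 < r -> is_derive r 1 q (dq r).
Hypothesis cdq : forall r : R, 0 < r -> {for r, continuous dq}.

Let E (y x : 'rV[R]_n) := expR (- lam * enorm (x - y)).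
Let S x := \sum_(y <- Y) E y x.
Let A i x := \sum_(y <- Y) E y x * (q (enorm (x - y)) * (x - y) ord0 i).
(** [dS] and [dA] are the derivatives of [S] and [A i] in direction [i]; in [dA], the term with
    [- lam] comes from the weight. *)
Let dS i x := \sum_(y <- Y) E y x * (- lam * ((x - y) ord0 i / enorm (x - y))).
Let dA i x := \sum_(y <- Y) E y x * (q (enorm (x - y)) +
  (dq (enorm (x - y)) - lam * q (enorm (x - y))) / enorm (x - y) * (x - y) ord0 i ^+ 2).

(* With q(r) = phi(r) / r, this is the i-th coordinate of sum_y w_y phi(r_y) grad r_y. *)
Definition softmin_field (i : 'I_n) x := A i x * (S x)^-1.
Definition softmin_field_deriv (i : 'I_n) x := dA i x * (S x)^-1 - A i x * dS i x * (S x)^-1 ^+ 2.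

Hypothesis Y0 : Y != [::].

Lemma softmin_total_gt0 x : 0 < S x.
Proof.
rewrite /S; case: Y Y0 => // y s _; rewrite big_cons ltr_wpDr// ?expR_gt0//.
by apply: sumr_ge0 => z _; exact: expR_ge0.
Qed.

Variable x : 'rV[R]_n.
Hypothesis xY : forall y, y \in Y -> x != y.

Let r_gt0 y : y \in Y -> 0 < enorm (x - y).
Proof. by move=> /xY H; rewrite enorm_gt0// subr_eq0. Qed.

(** The summand of [y] is differentiable only away from [y], so derivatives are available for
    members of [Y] only; at other indices the summand is replaced by 0 to apply [is_derive_big]. *)
Lemma is_derive_big_seq (f : 'rV[R]_n -> 'rV[R]_n -> R) (df : 'rV[R]_n -> R) v :
  (forall y, y \in Y -> is_derive x v (f y) (df y)) ->
  is_derive x v (fun x => \sum_(y <- Y) f y x) (\sum_(y <- Y) df y).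
Proof.
move=> H; rewrite big_seq.
rewrite (_ : (fun x => _) = (fun x => \sum_(y <- Y) (if y \in Y then f y x else 0))).
  rewrite big_mkcond /=; apply: is_derive_big => y; case: ifP => yY; first exact: H.
  exact: is_derive_cst.
by apply/funext => z; rewrite -big_mkcond -big_seq.
Qed.

Let is_derive_E y i : y \in Y ->
  is_derive x (ebasis R i) (E y) (E y x * (- lam * ((x - y) ord0 i / enorm (x - y)))).
Proof.
move=> yY; apply: (@is_derive_chain R _ expR (fun x : 'rV[R]_n => - lam * enorm (x - y))).
apply: is_derive_eq (is_derive_mul (is_derive_cst (- lam) x _) (is_derive_enorm i (xY yY))) _.
by rewrite mulr0 addr0.
Qed.

Lemma is_derive_softmin_field i :
  is_derive x (ebasis R i) (softmin_field i) (softmin_field_deriv i x).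
Proof.
have HS : is_derive x (ebasis R i) S (dS i x).
  by apply: is_derive_big_seq => y yY; exact: is_derive_E.
have HA : is_derive x (ebasis R i) (A i) (dA i x).
  apply: is_derive_big_seq => y yY; have r0 := r_gt0 yY.
  have Hq := is_derive_chain (g := fun x : 'rV[R]_n => enorm (x - y)) (hq r0) (is_derive_enorm i (xY yY)).
  apply: is_derive_eq (is_derive_mul (is_derive_E i yY) (is_derive_mul Hq (is_derive_coord y x i i))) _.
  rewrite eqxx mulr1 /=; set r := enorm _; set z := (x - y) ord0 i; set e := E y x.
  have r0' : r != 0 by exact: lt0r_neq0.
  field; exact: r0'.
have S0 := lt0r_neq0 (softmin_total_gt0 x).
apply: is_derive_eq (is_derive_mul HA (is_derive_inv S0 HS)) _.
by rewrite /softmin_field_deriv -exprVn; ring.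
Qed.

Let continuous_big_seq (f : 'rV[R]_n -> 'rV[R]_n -> R) :
  (forall y, y \in Y -> {for x, continuous (f y)}) ->
  {for x, continuous (fun x => \sum_(y <- Y) f y x)}.
Proof.
move=> H.
have -> : (fun x => \sum_(y <- Y) f y x) =
          (fun x => \sum_(y <- Y) (if y \in Y then f y x else 0)).
  by apply/funext => z; rewrite -big_mkcond -big_seq.
apply: (@continuous_sum _ _ _ _ (fun y x => if y \in Y then f y x else 0)) => y.
by have := H y; case: (y \in Y) => [/(_ isT)//|_]; exact: cst_continuous.
Qed.

Let continuous_r y : {for x, continuous (fun x : 'rV[R]_n => enorm (x - y))}.
Proof. exact: (@continuous_translate _ _ (fun z : 'rV[R]_n => enorm z) (- y) enorm_continuous). Qed.

Let continuous_E y : {for x, continuous (E y)}.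
Proof.
apply: (@continuous_comp _ _ _ (fun x : 'rV[R]_n => - lam * enorm (x - y)) expR); last exact: continuous_expR.
by apply: continuousM; [exact: cst_continuous|exact: continuous_r].
Qed.

Let continuous_z y i : {for x, continuous (fun x : 'rV[R]_n => (x - y) ord0 i)}.
Proof.
exact: (@continuous_translate _ _ (fun z : 'rV[R]_n => z ord0 i) (- y) (@coord_continuous R _ _ _ _)).
Qed.

Let continuous_radial (g : R -> R) y : y \in Y -> {for enorm (x - y), continuous g} ->
  {for x, continuous (fun x : 'rV[R]_n => g (enorm (x - y)))}.
Proof. by move=> yY cg; apply: continuous_comp; [exact: continuous_r|exact: cg]. Qed.

Let continuous_q y : y \in Y -> {for enorm (x - y), continuous q}.
Proof.
move=> yY; have [dq' _] := hq (r_gt0 yY).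
exact/differentiable_continuous/derivable1_diffP.
Qed.

Let continuous_rV y : y \in Y -> {for x, continuous (fun x : 'rV[R]_n => (enorm (x - y))^-1)}.
Proof.
by move=> yY; apply: (continuous_radial (g := GRing.inv)) => //; apply: inv_continuous; exact/lt0r_neq0/r_gt0.
Qed.

Let continuous_SV : {for x, continuous (fun x => (S x)^-1)}.
Proof.
apply: (@continuous_comp _ _ _ S GRing.inv); first by apply: continuous_big_seq => y _; exact: continuous_E.
by apply: inv_continuous; exact/lt0r_neq0/softmin_total_gt0.
Qed.

Let continuous_A i : {for x, continuous (A i)}.
Proof.
apply: continuous_big_seq => y yY; apply: continuousM; first exact: continuous_E.
apply: continuousM; last exact: continuous_z.
exact: (continuous_radial yY (continuous_q yY)).
Qed.

Lemma softmin_field_continuous i : {for x, continuous (softmin_field i)}.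
Proof. by apply: continuousM; [exact: continuous_A|exact: continuous_SV]. Qed.

Lemma softmin_field_deriv_continuous i : {for x, continuous (softmin_field_deriv i)}.
Proof.
apply: continuousB.
  apply: continuousM; last exact: continuous_SV.
  apply: continuous_big_seq => y yY; apply: continuousM; first exact: continuous_E.
  apply: continuousD; first exact: (continuous_radial yY (continuous_q yY)).
  apply: continuousM; last by apply: continuousM; exact: continuous_z.
  apply: continuousM; last exact: continuous_rV.
  apply: continuousB; first exact: (continuous_radial yY (cdq (r_gt0 yY))).
  apply: continuousM; first exact: cst_continuous.
  exact: (continuous_radial yY (continuous_q yY)).
apply: continuousM; last by apply: continuousM; exact: continuous_SV.
apply: continuousM; first exact: continuous_A.
apply: continuous_big_seq => y yY; apply: continuousM; first exact: continuous_E.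
apply: continuousM; first exact: cst_continuous.
by apply: continuousM; [exact: continuous_z|exact: continuous_rV].
Qed.

(** [flux_bound] takes absolute values in each coordinate, so this pairing is bounded rather than
    the length of the field. Nothing is lost: Cauchy-Schwarz applies to the absolute coordinates of
    each [x - y], and the weights average the resulting bounds. *)
Lemma softmin_field_norm_le (a : 'I_n -> R) (B : R) : (forall i, 0 <= a i) ->
  (forall y, y \in Y -> enorm (x - y) * q (enorm (x - y)) <= B) ->
  \sum_i a i * `|softmin_field i x| <= Num.sqrt (\sum_i a i ^+ 2) * B.
Proof.
move=> a0 qB; have S0 := softmin_total_gt0 x; have SV0 : 0 <= (S x)^-1 by rewrite invr_ge0 ltW.
set N := Num.sqrt _.
apply: (@le_trans _ _ (\sum_i a i * ((\sum_(y <- Y) E y x * (q (enorm (x - y)) * `|(x - y) ord0 i|)) * (S x)^-1))).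
  apply: ler_sum => i _; rewrite ler_wpM2l// /softmin_field normrM (ger0_norm SV0).
  rewrite ler_wpM2r//; apply: le_trans (ler_norm_sum _ _ _) _.
  rewrite big_seq [leRHS]big_seq; apply: ler_sum => y yY.
  by rewrite !normrM (ger0_norm (expR_ge0 _)) (ger0_norm (q0 (r_gt0 yY))).
under eq_bigr do rewrite mulrA mulr_sumr.
rewrite -mulr_suml ler_pdivrMr// exchange_big /= [S x in leRHS]/S mulr_sumr.
rewrite big_seq [leRHS]big_seq; apply: ler_sum => y yY.
have qy := q0 (r_gt0 yY).
rewrite (eq_bigr (fun i => E y x * q (enorm (x - y)) * (a i * `|(x - y) ord0 i|))); last first.
  by move=> i _; ring.
rewrite -mulr_sumr.
have H : \sum_i a i * `|(x - y) ord0 i| <= N * enorm (x - y).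
  apply: le_trans (cauchy_schwarz _ _) _; rewrite /N /enorm.
  by under [X in _ * Num.sqrt X]eq_bigr do rewrite real_normK ?num_real//.
have E0 : 0 <= E y x by exact: expR_ge0.
apply: le_trans (ler_wpM2l _ H) _; first exact: mulr_ge0.
have -> : E y x * q (enorm (x - y)) * (N * enorm (x - y)) =
  N * E y x * (enorm (x - y) * q (enorm (x - y))) by ring.
have -> : N * B * E y x = N * E y x * B by ring.
by rewrite ler_wpM2l ?qB// mulr_ge0// sqrtr_ge0.
Qed.

(* The derivatives of the weights contribute the sum over y, y' of
   lam * w_y * w_y' * q(r_y) * (z_y . z_y' / r_y' - r_y), which is nonpositive
   by Cauchy-Schwarz. *)
Lemma softmin_field_div_le :
  \sum_i softmin_field_deriv i x <=
  (\sum_(y <- Y) E y x * (n%:R * q (enorm (x - y)) + enorm (x - y) * dq (enorm (x - y)))) * (S x)^-1.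
Proof.
have S0 := softmin_total_gt0 x.
pose r y := enorm (x - y); pose Q := \sum_(y <- Y) E y x * (r y * q (r y)).
rewrite sumrB -mulr_suml -mulr_suml.
(* Summation over the coordinates turns the squares into [r y ^+ 2]; the derivatives of the weights
   in the numerator contribute [- lam * Q]. *)
have -> : \sum_i dA i x =
    \sum_(y <- Y) E y x * (n%:R * q (r y) + r y * dq (r y)) - lam * Q.
  rewrite exchange_big /= /Q mulr_sumr -sumrB [LHS]big_seq [RHS]big_seq.
  apply: eq_bigr => y yY; rewrite -mulr_sumr big_split /= sumr_const card_ord.
  rewrite -mulr_sumr -sqr_enorm -mulr_natl -/(r y).
  field; exact/lt0r_neq0/r_gt0.
have H : - (lam * Q * S x) <= \sum_i A i x * dS i x.
  have -> : \sum_i A i x * dS i x = - lam * \sum_(y <- Y) \sum_(y' <- Y)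
      E y x * q (r y) * E y' x / r y' * \sum_i (x - y) ord0 i * (x - y') ord0 i.
    under eq_bigr do rewrite big_distrlr /=.
    rewrite exchange_big /= mulr_sumr; apply: eq_bigr => y _.
    rewrite exchange_big /= mulr_sumr; apply: eq_bigr => y' _.
    by rewrite mulrA mulr_sumr; apply: eq_bigr => i _; rewrite /r; ring.
  rewrite mulNr lerN2 -mulrA ler_wpM2l// /Q /S big_distrlr /=.
  rewrite big_seq [leRHS]big_seq; apply: ler_sum => y yY.
  rewrite big_seq [leRHS]big_seq; apply: ler_sum => y' y'Y.
  have E0 z : 0 <= E z x by exact: expR_ge0.
  have qy := q0 (r_gt0 yY); have ry' := r_gt0 y'Y.
  apply: le_trans (ler_wpM2l _ (cauchy_schwarz _ _)) _.
    by rewrite !mulr_ge0// invr_ge0 ltW.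
  rewrite -/(enorm (x - y)) -/(enorm (x - y')) -/(r y) -/(r y') le_eqVlt; apply/orP; left.
  by apply/eqP; field; exact: lt0r_neq0.
(* The derivative of the normalizing factor raises the divergence by at most [lam * Q / S x], which
   the term [- lam * Q] of the numerator offsets. *)
have K : - (lam * Q) * (S x)^-1 <= (\sum_i A i x * dS i x) * (S x)^-1 ^+ 2.
  have -> : - (lam * Q) * (S x)^-1 = - (lam * Q * S x) * (S x)^-1 ^+ 2.
    by field; exact: lt0r_neq0.
  by rewrite ler_wpM2r// sqr_ge0.
by rewrite mulrBl -subr_ge0; move: K; rewrite -subr_ge0; congr (0 <= _); ring.
Qed.
End softmin_field.

(** * The radial profile *)

Section profile.
Context {R : realType}.

(** The density multiplying [|u|] on the right-hand side of the theorem for [C = gam - 1], as a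
    function of the distance. *)
Definition hardy_weight (n : nat) (s gam rad : R) (d : R) :=
  (s - n%:R) / d `^ s + (gam - 1) / rad `^ (s - n%:R) * (Xfun (d / rad) `^ gam / d ^+ n).

Variables (n : nat) (s gam rad delta : R).
Hypotheses (n0 : (0 < n)%N) (ns : n%:R <= s) (gam1 : 1 < gam) (rad0 : 0 < rad).
Hypotheses (delta0 : 0 < delta) (delta1 : delta <= 1).

(* The profile is q(r) = r^(-n) psi(r), where
   psi(r) = rad'^(n-s) (e^(a th) - (1 + th)^(1-gam)) and th = log(rad'/r) would give
   r^(n-s) - rad'^(n-s) X^(gam-1)(r/rad'). This changes sign at r = rad', whereas the soft
   minimum involves arbitrarily distant points; so th is the softplus
   p^-1 log(1 + e^(p sg)) of sg = log(rad e^delta / r), which is positive everywhere. *)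
Let p := 2 / delta ^+ 2.
Let l1 := ln rad + delta.
Let a := s - n%:R.
Let c0 := - a * (l1 + p^-1).
Let w (r : R) := expR (p * (l1 - ln r)).
Let th (r : R) := p^-1 * ln (1 + w r).
Let F (r : R) := expR (a * th r) - expR ((1 - gam) * ln (1 + th r)).
(** The derivative of [F] with respect to [th]. The logistic factor [dth] below is [- r] times the
    derivative of [th]. *)
Let G (r : R) := a * expR (a * th r) + (gam - 1) * expR (- gam * ln (1 + th r)).
Let h (r : R) := expR (c0 - n%:R * ln r).
Let dth (r : R) := w r * (1 + w r)^-1.

Definition profile r := h r * F r.
Definition profile_deriv r := h r * (- n%:R * F r - G r * dth r) * r^-1.

Let a0 : 0 <= a. Proof. by rewrite subr_ge0. Qed.
Let p0 : 0 < p. Proof. by rewrite divr_gt0// exprn_gt0. Qed.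
Let w0 (r : R) : 0 < w r. Proof. exact: expR_gt0. Qed.
Let th0 (r : R) : 0 < th r.
Proof. by rewrite mulr_gt0 ?invr_gt0// ln_gt0// ltrDl w0. Qed.
Let th1 (r : R) : 0 < 1 + th r. Proof. by rewrite addr_gt0// th0. Qed.
Let w1 (r : R) : 0 < 1 + w r. Proof. by rewrite addr_gt0// w0. Qed.

Let F_ge0 (r : R) : 0 <= F r.
Proof.
rewrite subr_ge0 ler_expR; apply: (@le_trans _ _ 0).
  by rewrite mulr_le0_ge0// ?subr_le0 ?ltW// ln_gt0// ltrDl th0.
by rewrite mulr_ge0// ltW// th0.
Qed.

Lemma profile_ge0 (r : R) : 0 <= profile r.
Proof. by rewrite mulr_ge0 ?expR_ge0 ?F_ge0. Qed.

Let G_ge0 (r : R) : 0 <= G r.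
Proof. by rewrite addr_ge0// mulr_ge0 ?expR_ge0// subr_ge0 ltW. Qed.

(** The left side is the divergence of the field [q(|z|) z] for [q = profile]. Since [h] is a
    constant times [r^(-n)], whose field is divergence free, only the derivative of [F] remains. *)
Lemma profile_div (r : R) : 0 < r ->
  n%:R * profile r + r * profile_deriv r = - (h r * G r * dth r).
Proof. by move=> r0; rewrite /profile /profile_deriv; field; exact: lt0r_neq0. Qed.

Let dth_ge0 (r : R) : 0 <= dth r.
Proof. by apply: mulr_ge0; rewrite ?invr_ge0; exact: ltW. Qed.

Lemma profile_div_le0 (r : R) : 0 < r -> n%:R * profile r + r * profile_deriv r <= 0.
Proof.
move=> r0; rewrite profile_div// oppr_le0.
by apply: mulr_ge0; [apply: mulr_ge0; [exact: expR_ge0|exact: G_ge0]|exact: dth_ge0].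
Qed.

Let is_derive_scale (f : R -> R) (k r df : R) :
  is_derive r 1 f df -> is_derive r 1 (fun r => k * f r) (k * df).
Proof.
move=> hf; apply: is_derive_eq (is_derive_mul (is_derive_cst k r _) hf) _.
by rewrite mulr0 addr0.
Qed.

Let is_derive_shiftc (f : R -> R) (k r df : R) :
  is_derive r 1 f df -> is_derive r 1 (fun r => k + f r) df.
Proof.
move=> hf; apply: is_derive_eq (is_derive_add (is_derive_cst k r _) hf) _.
by rewrite add0r.
Qed.

Let is_derive_logneg (k1 k2 r : R) : 0 < r ->
  is_derive r 1 (fun r => k1 - k2 * ln r) (- (k2 * r^-1)).
Proof.
move=> r0; have H := is_derive_scale (- k2) (is_derive1_ln r0).
have E : (fun r => k1 - k2 * ln r) = (fun r => k1 + - k2 * ln r).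
  by apply/funext => x; rewrite mulNr.
by rewrite E; apply: is_derive_eq (is_derive_shiftc k1 H) _; rewrite mulNr.
Qed.

Let is_derive_exp (f : R -> R) (r df : R) :
  is_derive r 1 f df -> is_derive r 1 (fun r => expR (f r)) (expR (f r) * df).
Proof. exact: (is_derive_chain (h := expR) (is_derive_expR _)). Qed.

Let is_derive_w (r : R) : 0 < r -> is_derive r 1 w (w r * - (p * r^-1)).
Proof.
move=> r0; have H := is_derive_logneg (p * l1) p r0.
have E : w = (fun r => expR (p * l1 - p * ln r)).
  by apply/funext => x; rewrite /w mulrBr.
by rewrite E; exact: is_derive_exp H.
Qed.

Let is_derive_th (r : R) : 0 < r -> is_derive r 1 th (- (dth r * r^-1)).
Proof.
move=> r0; have H := is_derive_shiftc 1 (is_derive_w r0).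
have H2 := is_derive_chain (g := fun r => 1 + w r) (is_derive1_ln (w1 r)) H.
apply: is_derive_eq (is_derive_scale p^-1 H2) _; rewrite /dth.
by field; rewrite !lt0r_neq0.
Qed.

Lemma is_derive_profile (r : R) : 0 < r -> is_derive r 1 profile (profile_deriv r).
Proof.
move=> r0.
have Hh : is_derive r 1 h (h r * - (n%:R * r^-1)).
  exact: is_derive_exp (is_derive_logneg _ _ r0).
have H1 := is_derive_exp (is_derive_scale a (is_derive_th r0)).
have H2 := is_derive_chain (g := fun r => 1 + th r) (is_derive1_ln (th1 r)) (is_derive_shiftc 1 (is_derive_th r0)).
have H3 := is_derive_exp (is_derive_scale (1 - gam) H2).
have HF : is_derive r 1 F (- (G r * dth r * r^-1)).
  have := is_derive_add H1 (is_derive_scale (-1) H3).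
  rewrite (_ : (fun r => _ + _) = F); last by apply/funext => x; rewrite mulN1r.
  move=> H; apply: is_derive_eq H _; rewrite /G.
  have -> : expR (- gam * ln (1 + th r)) = expR ((1 - gam) * ln (1 + th r)) * (1 + th r)^-1.
    have : 1 + th r = expR (ln (1 + th r)) by rewrite lnK// posrE.
    by set L := ln _ => ->; rewrite -expRN -expRD; congr expR; ring.
  by ring.
by apply: is_derive_eq (is_derive_mul Hh HF) _; rewrite /profile_deriv; ring.
Qed.

Let continuous_of_derive (f : R -> R) (r df : R) : is_derive r 1 f df -> {for r, continuous f}.
Proof. by move=> [H _]; apply/differentiable_continuous/derivable1_diffP. Qed.

Lemma profile_deriv_continuous (r : R) : 0 < r -> {for r, continuous profile_deriv}.
Proof.
move=> r0; have cth := continuous_of_derive (is_derive_th r0).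
have cw := continuous_of_derive (is_derive_w r0).
have cln : {for r, continuous (@ln R)} by exact: continuous_ln.
have cexp (f : R -> R) : {for r, continuous f} -> {for r, continuous (fun x => expR (f x))}.
  by move=> cf; apply: (continuous_comp cf); exact: continuous_expR.
have cscale (f : R -> R) (k : R) : {for r, continuous f} -> {for r, continuous (fun x => k * f x)}.
  by move=> cf; apply: continuousM => //; exact: cst_continuous.
have clth : {for r, continuous (fun x => ln (1 + th x))}.
  apply: (@continuous_comp _ _ _ (fun x => 1 + th x) (@ln R)).
    by apply: continuousD => //; exact: cst_continuous.
  exact: continuous_ln.
apply: continuousM; last by apply: inv_continuous; exact: lt0r_neq0.
apply: continuousM.
  apply: cexp; apply: continuousB; first exact: cst_continuous.
  exact: cscale.
apply: continuousB.
  exact/cscale/(continuousB (cexp _ (cscale _ a cth)) (cexp _ (cscale _ (1 - gam) clth))).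
apply: continuousM.
  exact: (continuousD (cscale _ a (cexp _ (cscale _ a cth)))
    (cscale _ (gam - 1) (cexp _ (cscale _ (- gam) clth)))).
apply: continuousM => //.
apply: (@continuous_comp _ _ _ (fun x => 1 + w x) GRing.inv).
  by apply: continuousD => //; exact: cst_continuous.
by apply: inv_continuous; exact: lt0r_neq0.
Qed.

(** For [x >= 0], [1 + e^x <= 2 e^x <= e^(1 + x)]; so the softplus exceeds a nonnegative argument by
    at most [p^-1]. *)
Let ln_1w_le (r : R) : 0 <= l1 - ln r -> th r <= l1 - ln r + p^-1.
Proof.
move=> sg0; rewrite /th mulrC ler_pdivrMr// mulrDl mulVf ?lt0r_neq0//.
rewrite -[leRHS]expRK; rewrite ler_ln ?posrE ?expR_gt0//.
rewrite expRD mulrC; apply: (@le_trans _ _ ((1 + 1) * w r)).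
  rewrite mulrDl mul1r lerD2r -expR0 ler_expR; exact: (mulr_ge0 (ltW p0)).
by rewrite /w [_ * p]mulrC ler_wpM2r ?expR_ge0// expR_ge1Dx.
Qed.

(** As [r] may be arbitrarily large, [ln_1w_le] is applied at [d] and transferred to [r] because
    [th] decreases. The factor [r^(1 - n)] is then at most [d^(1 - n)], as [n >= 1]. *)
Lemma profile_le (d r : R) : 0 < d -> d <= rad -> d <= r ->
  r * profile r <= (d `^ (s - 1))^-1.
Proof.
move=> d0 dR dr; have r0 := lt_le_trans d0 dr.
have lndr : ln d <= ln r by rewrite ler_ln ?posrE.
have lndR : ln d <= ln rad by rewrite ler_ln ?posrE.
have sg0 : 0 <= l1 - ln d by rewrite /l1; have := delta0; lra.
have thd := ln_1w_le sg0.
have thr : th r <= th d.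
  rewrite /th ler_pM2l ?invr_gt0//; rewrite ler_ln ?posrE//.
  by rewrite lerD2l ler_expR ler_pM2l// lerD2l lerN2.
have n1 : 1 <= n%:R :> R by rewrite ler1n.
have Fr : F r <= expR (- c0 - a * ln d).
  apply: (@le_trans _ _ (expR (a * th r))).
    by rewrite gerBl expR_ge0.
  rewrite ler_expR /c0 mulNr opprK -mulrBr; apply: ler_wpM2l => //.
  by apply: le_trans thr (le_trans thd _); rewrite addrAC.
rewrite /powR gt_eqF// -expRN /profile -{1}(lnK (x := r)) ?posrE// mulrA -expRD.
apply: le_trans (ler_wpM2l (expR_ge0 _) Fr) _.
rewrite -expRD ler_expR /a -subr_ge0.
have -> : - ((s - 1) * ln d) - (ln r + (c0 - n%:R * ln r) + (- c0 - (s - n%:R) * ln d)) =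
  (n%:R - 1) * (ln r - ln d) by ring.
by rewrite mulr_ge0// subr_ge0.
Qed.

(** The factors of [h r * G r * dth r] are compared with their limits through logarithms; every
    discrepancy costs a multiple of [delta] in the exponent. *)
Lemma profile_div_ge (d r : R) : 0 < d -> d <= rad -> d <= r -> r <= d * expR (delta / 2) ->
  expR (- ((n%:R + 3 * (a + gam) + 1) * delta)) * hardy_weight n s gam rad d <=
  - (n%:R * profile r + r * profile_deriv r).
Proof.
move=> d0 dR dr rd; have r0 := lt_le_trans d0 dr.
have lndr : ln d <= ln r by rewrite ler_ln ?posrE.
have lndR : ln d <= ln rad by rewrite ler_ln ?posrE.
have lnrd : ln r <= ln d + delta / 2.
  rewrite -[X in _ + X]expRK -lnM ?posrE ?expR_gt0//; rewrite ler_ln ?posrE//.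
  by rewrite mulr_gt0 ?expR_gt0.
have pd : p^-1 <= delta / 2.
  rewrite /p invf_div ler_pM2r// expr2 ler_piMr//; exact: ltW.
have sgr : delta / 2 <= l1 - ln r by rewrite /l1; lra.
(* By the choice of [p], [p * (l1 - ln r) >= delta^-1]; hence [w r >= delta^-1] and [dth r >= (1 +
   delta)^-1 >= expR (- delta)]. *)
have dth_ge : expR (- delta) <= dth r.
  rewrite /dth ler_pdivlMr// expRN mulrC ler_pdivrMr ?expR_gt0//.
  have wd : delta^-1 <= w r.
    apply: (@le_trans _ _ (1 + p * (l1 - ln r))); last exact: expR_ge1Dx.
    have : p * (delta / 2) <= p * (l1 - ln r) by rewrite ler_pM2l.
    have -> : p * (delta / 2) = delta^-1 by rewrite /p; field; exact: lt0r_neq0.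
    lra.
  have H1 : 1 <= w r * delta by rewrite -ler_pdivrMr// mul1r.
  have H2 : w r * (1 + delta) <= w r * expR delta by rewrite ler_pM2l// expR_ge1Dx.
  lra.
have th_ge : l1 - ln r <= th r.
  rewrite /th mulrC ler_pdivlMr// -[leLHS]expRK; rewrite ler_ln ?posrE ?expR_gt0//.
  by rewrite [_ * p]mulrC lerDr.
have th_le : th r <= l1 - ln r + p^-1.
  by apply: ln_1w_le; apply: le_trans sgr; rewrite divr_ge0// ltW.
set tau := ln rad - ln d.
have tau0 : 0 <= tau by rewrite subr_ge0.
have tau1 : 0 < 1 + tau by rewrite ltr_pwDl.
(* Here [th r <= tau + 2 * delta], and [1 + tau + 2 * delta <= (1 + tau) * (1 + 2 * delta)]. *)
have ln_th : ln (1 + th r) <= ln (1 + tau) + 2 * delta.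
  have -> : ln (1 + tau) + 2 * delta = ln ((1 + tau) * expR (2 * delta)).
    by rewrite lnM ?posrE ?expR_gt0// expRK.
  rewrite ler_ln ?posrE//; last by rewrite mulr_gt0 ?expR_gt0.
  apply: (@le_trans _ _ ((1 + tau) * (1 + 2 * delta))); last first.
    by rewrite ler_pM2l// expR_ge1Dx.
  have := mulr_ge0 tau0 (ltW delta0); move: th_le; rewrite /l1 /tau => ? ?.
  have : 0 <= ln r - ln d by lra.
  nra.
have hwE : hardy_weight n s gam rad d = a * expR (- (s * ln d)) +
    (gam - 1) * expR (- (a * ln rad) - gam * ln (1 + tau) - n%:R * ln d).
  rewrite /hardy_weight /Xfun ln_div ?posrE// opprB addrA -/tau.
  have -> : 1 + ln rad - ln d = 1 + tau by rewrite /tau addrA.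
  rewrite -powR_mulrn ?ltW// /powR !gt_eqF ?invr_gt0// lnV ?posrE//.
  rewrite -!expRN -mulrA -!expRD; congr (_ + _ * expR _); rewrite /a; ring.
rewrite profile_div// opprK hwE.
(* The exponents of the two summands lose at most [(a + n/2 + 1) delta] and
   [(3a/2 + 2 gam + n/2 + 1) delta]; [K] dominates both. *)
set K := _ * delta.
have hn : 0 <= n%:R * (ln d + delta / 2 - ln r) by rewrite mulr_ge0//; lra.
have G1 : expR (- K) * (a * expR (- (s * ln d))) <=
    h r * (a * expR (a * th r)) * expR (- delta).
  have -> : h r * (a * expR (a * th r)) * expR (- delta) =
    a * (expR (c0 - n%:R * ln r) * expR (a * th r) * expR (- delta)) by rewrite /h; ring.
  rewrite mulrCA ler_wpM2l// -!expRD ler_expR.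
  have H1 : a * (l1 - ln r) <= a * th r by rewrite ler_wpM2l.
  have H2 : 0 <= a * (ln d + delta / 2 - ln r) by rewrite mulr_ge0//; lra.
  have H3 : 0 <= a * (delta / 2 - p^-1) by rewrite mulr_ge0//; lra.
  have H4 : 0 <= n%:R * delta by rewrite mulr_ge0// ltW.
  have H5 : 0 <= a * delta by rewrite mulr_ge0// ltW.
  have H6 : 0 <= gam * delta by rewrite mulr_ge0// ltW// (lt_trans _ gam1).
  rewrite /K /c0; move: H1 H2 H3 H5 hn; rewrite /a; lra.
have G2 : expR (- K) * ((gam - 1) * expR (- (a * ln rad) - gam * ln (1 + tau) - n%:R * ln d)) <=
    h r * ((gam - 1) * expR (- gam * ln (1 + th r))) * expR (- delta).
  have -> : h r * ((gam - 1) * expR (- gam * ln (1 + th r))) * expR (- delta) =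
    (gam - 1) * (expR (c0 - n%:R * ln r) * expR (- gam * ln (1 + th r)) * expR (- delta)).
    by rewrite /h; ring.
  have gam10 : 0 <= gam - 1 by rewrite subr_ge0 ltW.
  rewrite mulrCA ler_wpM2l// -!expRD ler_expR.
  have H1 : gam * ln (1 + th r) <= gam * (ln (1 + tau) + 2 * delta).
    by rewrite ler_wpM2l// ltW// (lt_trans _ gam1).
  have H3 : 0 <= a * (delta / 2 - p^-1) by rewrite mulr_ge0//; lra.
  have H4 : 0 <= n%:R * delta by rewrite mulr_ge0// ltW.
  have H5 : 0 <= a * delta by rewrite mulr_ge0// ltW.
  have H6 : 0 <= gam * delta by rewrite mulr_ge0// ltW// (lt_trans _ gam1).
  rewrite /K /c0 /l1; move: H1 H3 H5 hn; lra.
have hG : 0 <= h r * G r by rewrite mulr_ge0 ?expR_ge0 ?G_ge0.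
apply: le_trans (ler_wpM2l hG dth_ge).
by rewrite mulrDr; apply: le_trans (lerD G1 G2) _; rewrite -mulrDl -mulrDr.
Qed.
End profile.

(** * Concentration of the weights and the final estimate *)

Section assembly.
Context {R : realType}.

(** A point with [r y > rho1] has weight at most [expR (- (lam * (rho1 - rho0)))] times that of
    [y0], hence at most this fraction of the total; there are at most [size Y] such points. *)
Lemma softmin_concentration (T : eqType) (Y : seq T) (lam : R) (r k : T -> R)
    (kappa rho0 rho1 : R) (y0 : T) : 0 <= lam -> 0 <= kappa -> y0 \in Y -> r y0 <= rho0 ->
  (forall y, y \in Y -> 0 <= k y) ->
  (forall y, y \in Y -> r y <= rho1 -> kappa <= k y) ->
  kappa * (1 - (size Y)%:R * expR (- (lam * (rho1 - rho0)))) *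
    (\sum_(y <- Y) expR (- lam * r y)) <= \sum_(y <- Y) expR (- lam * r y) * k y.
Proof.
move=> lam0 kappa0 y0Y ry0 k0 kk; set S := \sum_(y <- Y) expR (- lam * r y).
set eta := expR (- (lam * (rho1 - rho0))).
have ES : expR (- lam * r y0) <= S.
  by rewrite /S (big_rem y0)//= lerDl sumr_ge0// => y _; exact: expR_ge0.
(* Charging the loss [kappa * eta * S] to every index reduces the claim to a termwise inequality. *)
have -> : kappa * (1 - (size Y)%:R * eta) * S =
    \sum_(y <- Y) (kappa * expR (- lam * r y) - kappa * eta * S).
  rewrite sumrB -mulr_sumr -/S big_const_seq count_predT iter_addr_0 -mulr_natr; ring.
rewrite big_seq [leRHS]big_seq; apply: ler_sum => y yY.
have eta0 : 0 <= eta by exact: expR_ge0.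
have S0 : 0 <= S by apply: le_trans ES; exact: expR_ge0.
have Ey := expR_ge0 (- lam * r y).
have [rr|rr] := leP (r y) rho1.
  apply: (@le_trans _ _ (kappa * expR (- lam * r y))).
    by rewrite gerBl !mulr_ge0.
  by rewrite mulrC ler_wpM2l// kk.
apply: (@le_trans _ _ 0); last by rewrite mulr_ge0// k0.
rewrite subr_le0 -mulrA ler_wpM2l//.
apply: (@le_trans _ _ (eta * expR (- lam * r y0))); last by rewrite ler_wpM2l.
rewrite -expRD ler_expR.
have : 0 <= lam * (r y - rho1) by rewrite mulr_ge0// subr_ge0 ltW.
have : 0 <= lam * (rho0 - r y0) by rewrite mulr_ge0// subr_ge0.
lra.
Qed.

Lemma box_integral_sum (n : nat) (M : R) (I : Type) (r : seq I) (f : I -> 'rV[R]_n -> R) :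
  0 <= M -> (forall i, continuous (f i)) -> (forall i, box_supported M (f i)) ->
  box_integral (fun x => \sum_(i <- r) f i x) = \sum_(i <- r) box_integral (f i).
Proof.
move=> M0 cf sf; elim: r => [|i r IH].
  rewrite big_nil -[RHS](box_integral0 n); congr box_integral.
  by apply/funext => x; rewrite big_nil.
rewrite big_cons -IH -[box_integral (f i)]mul1r -(box_integral_axpy M0)//.
- by congr box_integral; apply/funext => x; rewrite big_cons mul1r.
- by move=> x; exact: (continuous_sum (fun j => @cf j x)).
- by move=> x j xM; rewrite big1// => k _; exact: sf xM.
Qed.

Lemma compact_box (n : nat) (K : set 'rV[R]_n) : compact K ->
  exists2 M : R, 0 <= M & forall x j, K x -> `|x ord0 j| <= M.
Proof.
move=> /compact_bounded[M [Mr KM]]; exists (`|M| + 1); first by rewrite addr_ge0.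
move=> x j Kx; have : `|x| <= `|M| + 1.
  by apply: KM => //; rewrite (le_lt_trans (ler_norm _))// ltrDl.
apply: le_trans; rewrite [leRHS]/Num.norm /= mx_normrE.
by apply/bigmax_geP; right; exists (ord0, j).
Qed.

Lemma compact_lower_bound (T : topologicalType) (K : set T) (f : T -> R) :
  compact K -> continuous f -> (forall x, K x -> 0 < f x) ->
  exists2 m : R, 0 < m & forall x, K x -> m <= f x.
Proof.
move=> cK cf f0.
have H : \forall m \near (0:R)^'+, K `<=` (fun x => m <= f x).
  apply: (iffLR (compact_near_coveringP _) cK R ((0:R)^'+) (fun m x => m <= f x)) => x Kx.
  have fx2 : 0 < f x / 2 by rewrite divr_gt0// f0.
  near=> x' m => /=.
  have mx : m <= f x / 2 by near: m; exact: nbhs_right_le.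
  have : `|f x - f x'| <= f x / 2.
    by near: x'; have /cvgrPdist_le := cf x; apply.
  by rewrite ler_norml => /andP[_]; lra.
have [m [m0 Hm]] := @filter_ex _ ((0:R)^'+) _ _ (filterI (nbhs_right_gt (0:R)) H).
by exists m.
Unshelve. all: by end_near. Qed.

(** Each point outside [Om] is nearly closest for an open set of [x]; these sets cover [K], and
    compactness leaves finitely many. *)
Lemma finite_net (n : nat) (Om K : set 'rV[R]_n) (c : R) : open Om -> Om != setT ->
  compact K -> K `<=` Om -> 1 < c ->
  exists Y : seq 'rV[R]_n, [/\ Y != [::], forall y, y \in Y -> ~ Om y &
    forall x, K x -> exists2 y, y \in Y & enorm (x - y) <= dist_compl Om x * c].
Proof.
move=> oOm pOm cK KOm c1.
have [y0 ny0] : exists y, ~ Om y.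
  apply/existsNP => H; move/eqP: pOm; apply; apply/seteqP; split => // x _; exact: H.
have cU y : continuous (fun x : 'rV[R]_n => dist_compl Om x * c - enorm (x - y)).
  have cd : continuous (fun x : 'rV[R]_n => c * dist_compl Om x + 0).
    by apply: continuous_axpy; [exact: dist_continuous|exact: cst_continuous].
  have ce : continuous (fun x : 'rV[R]_n => enorm (x - y)).
    exact: (@continuous_translate _ _ (fun z : 'rV[R]_n => enorm z) (- y) enorm_continuous).
  rewrite (_ : (fun x => _) = (fun x => -1 * enorm (x - y) + (c * dist_compl Om x + 0))).
    exact: continuous_axpy.
  by apply/funext => x; rewrite addr0; ring.
move: (cK); rewrite compact_cover => /(_ _ (~` Om)
  (fun y => [set x : 'rV[R]_n | 0 < dist_compl Om x * c - enorm (x - y)]))[].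
- move=> y _; apply: (@open_comp _ _ _ [set t : R | 0 < t]); last exact: open_gt.
  by move=> x _; exact: cU.
- move=> x /KOm Ox; have d0 := dist_gt0 oOm pOm Ox.
  have [y nOy xy] := @dist_approx _ _ _ pOm x (dist_compl Om x * (c - 1)) (mulr_gt0 d0 (etrans (subr_gt0 _ _) c1)).
  by exists y => //=; rewrite subr_gt0; apply: lt_le_trans xy _; rewrite mulrBr mulr1 addrC subrK.
(* The additional point [y0] keeps the net nonempty when [K] is empty. *)
move=> D DOm cov; exists (y0 :: finmap.enum_fset D); split => //.
- by move=> y; rewrite inE => /orP[/eqP ->//|/DOm]; rewrite inE.
- move=> x /cov[y /= yD]; rewrite subr_gt0 => xy; exists y; last exact: ltW.
  by rewrite inE yD orbT.
Qed.
End assembly.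

(** * The Hardy inequality for a radius bounding the distance *)

Section hardy.
Context {R : realType} {n : nat} {Om : set 'rV[R]_n}.
Hypotheses (n0 : (0 < n)%N) (oOm : open Om) (pOm : Om != setT).
Variables (s gam rad : R).
Hypotheses (ns : n%:R <= s) (gam1 : 1 < gam) (rad0 : 0 < rad).
Local Notation d := (dist_compl Om).
Hypothesis d_le : forall x, Om x -> d x <= rad.

Let powR_for (a e : R) : 0 < a -> {for a, continuous (fun t : R => t `^ e)}.
Proof.
move=> a0; have [H _] := is_derive1_powR e a0.
exact/differentiable_continuous/derivable1_diffP.
Qed.

Lemma dist_powV_continuous (e : R) x : Om x -> {for x, continuous (fun x => (d x `^ e)^-1)}.
Proof.
move=> Ox; have d0 := dist_gt0 oOm pOm Ox.
apply: (@continuous_comp _ _ _ (fun x => d x `^ e) GRing.inv).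
  apply: (@continuous_comp _ _ _ (fun x => d x) (fun t : R => t `^ e)).
    exact: dist_continuous.
  exact: powR_for.
by apply: inv_continuous; rewrite lt0r_neq0// powR_gt0.
Qed.

Lemma dist_log_weight_continuous x : Om x ->
  {for x, continuous (fun x => (d x ^+ n)^-1 * Xfun (d x / rad) `^ gam)}.
Proof.
move=> Ox; have d0 := dist_gt0 oOm pOm Ox.
have c0 : 0 < 1 - ln (d x / rad).
  by rewrite subr_gt0 (le_lt_trans _ ltr01)// ln_le0// ler_pdivrMr// mul1r d_le.
have cd : {for x, continuous (fun x => d x)} by exact: dist_continuous.
apply: continuousM.
  apply: (@continuous_comp _ _ _ (fun x => d x ^+ n) GRing.inv).
    by apply: (@continuous_comp _ _ _ (fun x => d x) (fun t : R => t ^+ n)) => //; exact: exprn_continuous.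
  by apply: inv_continuous; rewrite lt0r_neq0// exprn_gt0.
apply: (@continuous_comp _ _ _ (fun x => Xfun (d x / rad)) (fun t : R => t `^ gam)); last first.
  by apply: powR_for; rewrite invr_gt0.
apply: (@continuous_comp _ _ _ (fun x => 1 - ln (d x / rad)) GRing.inv); last first.
  by apply: inv_continuous; exact: lt0r_neq0.
apply: continuousB; first exact: cst_continuous.
apply: (@continuous_comp _ _ _ (fun x => d x / rad) (@ln R)); last first.
  by apply: continuous_ln; rewrite divr_gt0.
by apply: continuousM => //; exact: cst_continuous.
Qed.

Variables (u : 'rV[R]_n -> R).
Hypothesis hu : Cc_infty Om u.

Let K := fsupport u.
Let du (i : 'I_n) (x : 'rV[R]_n) := derive u x (ebasis R i).

Let cu : continuous u. Proof. exact: (hu.1 [::]).1. Qed.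
Let cdu i : continuous (du i). Proof. exact: (hu.1 [:: i]).1. Qed.
Let hdu i x : is_derive x (ebasis R i) u (du i x).
Proof. by apply: derivableP; exact: (hu.1 [::]).2. Qed.
Let compK : compact K. Proof. exact: hu.2.1. Qed.
Let cK : closed K. Proof. exact: closed_closure. Qed.
Let KOm : K `<=` Om. Proof. exact: hu.2.2. Qed.
Let u0 x : ~ K x -> u x = 0.
Proof. by move=> nKx; apply/eqP/negPn/negP => ux; apply: nKx; exact: subset_closure. Qed.
Let du0 i x : ~ K x -> du i x = 0. Proof. exact: (du_supp cK u0 (@hdu i)). Qed.

Let grad0 x : ~ K x -> grad_norm u x = 0.
Proof.
move=> nKx; rewrite /grad_norm /enorm big1 ?sqrtr0// => i _.
by rewrite mxE [derive _ _ _]du0// expr0n.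
Qed.

Let grad_continuous : continuous (grad_norm u).
Proof.
move=> x; apply: (@continuous_comp _ _ _ (fun x => \row_(i < n) du i x) (fun v : 'rV[R]_n => enorm v)); last exact: enorm_continuous.
apply: (@rV_cvg R _ (nbhs (x : 'rV[R]_n)) _ n (fun x => \row_(i < n) du i x)) => j; rewrite mxE.
have -> : (fun x => (\row_(i < n) du i x) ord0 j) = du j by apply/funext => y; rewrite mxE.
exact: cdu.
Qed.

Let cnu : continuous (fun x => `|u x|). Proof. by move=> x; exact/continuous_normr/cu. Qed.

Let supp_of (M : R) (f : 'rV[R]_n -> R) : (forall x j, K x -> `|x ord0 j| <= M) ->
  (forall x, ~ K x -> f x = 0) -> box_supported M f.
Proof. by move=> KM f0 x j xM; apply: f0 => /KM -/(_ j); rewrite leNgt xM. Qed.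

Let Gr x := grad_norm u x / d x `^ (s - 1).
Let V1 x := `|u x| / d x `^ s.
Let V2 x := `|u x| / d x ^+ n * Xfun (d x / rad) `^ gam.

Let cGr : continuous Gr.
Proof.
apply: (continuous_mul_supp (K := K)) => // x Kx.
exact/dist_powV_continuous/KOm.
Qed.

Let cV1 : continuous V1.
Proof.
apply: (continuous_mul_supp (K := K)) => // [x nKx|x Kx]; first by rewrite u0// normr0.
exact/dist_powV_continuous/KOm.
Qed.

Let cV2 : continuous V2.
Proof.
rewrite (_ : V2 = (fun x => `|u x| * ((d x ^+ n)^-1 * Xfun (d x / rad) `^ gam))); last first.
  by apply/funext => x; rewrite mulrA.
apply: (continuous_mul_supp (K := K)) => // [x nKx|x Kx]; first by rewrite u0// normr0.
exact/dist_log_weight_continuous/KOm.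
Qed.

Let Gr0 x : ~ K x -> Gr x = 0. Proof. by move=> /grad0; rewrite /Gr => ->; rewrite mul0r. Qed.
Let V10 x : ~ K x -> V1 x = 0. Proof. by move=> /u0; rewrite /V1 => ->; rewrite normr0 mul0r. Qed.
Let V20 x : ~ K x -> V2 x = 0. Proof. by move=> /u0; rewrite /V2 => ->; rewrite normr0 !mul0r. Qed.

Let W x := (s - n%:R) * V1 x + (gam - 1) / rad `^ (s - n%:R) * V2 x.

Let WE x : W x = `|u x| * hardy_weight n s gam rad (d x).
Proof. by rewrite /W /V1 /V2 /hardy_weight; ring. Qed.

Let cW : continuous W.
Proof.
apply: continuous_axpy => //.
rewrite (_ : (fun x => _) = (fun x => (gam - 1) / rad `^ (s - n%:R) * V2 x + 0)).
  by apply: continuous_axpy => //; exact: cst_continuous.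
by apply/funext => x; rewrite addr0.
Qed.

Let W0 x : ~ K x -> W x = 0.
Proof. by move=> nKx; rewrite /W V10// V20// !mulr0 addr0. Qed.

Lemma hardy_weight_ge0 x : Om x -> 0 <= hardy_weight n s gam rad (d x).
Proof.
move=> Ox; have d0 := dist_gt0 oOm pOm Ox.
rewrite /hardy_weight addr_ge0// mulr_ge0// ?invr_ge0 ?powR_ge0 ?subr_ge0//.
  by rewrite mulr_ge0 ?invr_ge0 ?powR_ge0// subr_ge0 ltW.
by rewrite mulr_ge0 ?invr_ge0 ?powR_ge0// exprn_ge0// ltW.
Qed.

(** The soft minimum field is used with [delta = t]: the factor [1 - t] pays for the weight of far
    points, the exponential for the smoothed profile. *)
Lemma hardy_approx (t : R) : 0 < t -> t <= 1 ->
  (1 - t) * expR (- ((n%:R + 3 * (s - n%:R + gam) + 1) * t)) * box_integral W <= box_integral Gr.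
Proof.
move=> t0 t1.
set c := (1 - t) * _.
have c_ge0 : 0 <= c by rewrite mulr_ge0 ?subr_ge0 ?expR_ge0.
have e1 : 1 < expR (t / 4) by rewrite expR_gt1// divr_gt0.
have [Y [Y0 YOm Ynet]] := finite_net oOm pOm compK KOm e1.
have [m m0 mK] := compact_lower_bound compK (dist_continuous pOm) (fun x Kx => dist_gt0 oOm pOm (KOm Kx)).
have [M M0 KM] := compact_box compK.
pose g := expR (t / 2) - expR (t / 4).
have g0 : 0 < g by rewrite subr_gt0 ltr_expR; lra.
(* [g] is the gap between the net ratio [expR (t / 4)] and the ratio [expR (t / 2)] allowed in
   [profile_div_ge]. As [m <= d x] on [K] and [z <= expR z], this [lam] makes the relative weight of
   far points at most [t]. *)
pose lam := (size Y)%:R / (t * m * g).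
have lam0 : 0 <= lam by rewrite divr_ge0// !mulr_ge0// ltW.
pose q := profile n s gam rad t; pose dq := profile_deriv n s gam rad t.
have q0 (r : R) : 0 < r -> 0 <= q r by move=> _; exact: profile_ge0.
have hq (r : R) : 0 < r -> is_derive r 1 q (dq r) by exact: is_derive_profile.
have cdq (r : R) : 0 < r -> {for r, continuous dq} by exact: profile_deriv_continuous.
pose T i x := softmin_field Y lam q i x.
pose D i x := softmin_field_deriv Y lam q dq i x.
have xY x : Om x -> forall y, y \in Y -> x != y.
  by move=> Ox y /YOm nOy; apply/eqP => xy; apply: nOy; rewrite -xy.
have cT i x : Om x -> {for x, continuous (T i)}.
  by move=> Ox; exact: (softmin_field_continuous hq Y0 (xY x Ox)).
have cD i x : Om x -> {for x, continuous (D i)}.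
  by move=> Ox; exact: (softmin_field_deriv_continuous hq cdq Y0 (xY x Ox)).
have hT i x : Om x -> is_derive x (ebasis R i) (T i) (D i x).
  by move=> Ox; exact: (is_derive_softmin_field lam hq Y0 (xY x Ox)).
pose B i x := `|du i x| * `|T i x| + `|u x| * D i x.
have cB i : continuous (B i).
  exact: (flux_bound_continuous cK u0 cu (@cdu i) (@hdu i) KOm (cT i) (cD i)).
have sB i : box_supported M (B i).
  exact: (flux_bound_supp cK u0 (@hdu i) KM).
have B_ge0 : 0 <= \sum_i box_integral (B i).
  apply: sumr_ge0 => i _.
  exact: (flux_bound_integral_ge0 cK u0 cu (@cdu i) (@hdu i) oOm KOm (cT i) (cD i) (hT i) M0 KM).
rewrite -(box_integral_sum _ M0 cB sB) in B_ge0.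
have cS : continuous (fun x => - c * W x + Gr x) by exact: continuous_axpy.
have sW : box_supported M W by exact: supp_of.
have sGr : box_supported M Gr by exact: supp_of.
(* It remains to compare integrands: on [K], the divergence part of [B] is at most [- c * W], and
   the gradient part at most [Gr]. *)
suff : box_integral (fun x => \sum_i B i x) <= box_integral (fun x => - c * W x + Gr x).
  by rewrite (box_integral_axpy M0)//; lra.
apply: (le_box_integral M0) => //.
- by move=> x; exact: (continuous_sum (fun j => @cB j x)).
- by move=> x j xM; rewrite big1// => i _; exact: sB xM.
- by move=> x j xM; rewrite (sW _ _ xM) (sGr _ _ xM) mulr0 addr0.
move=> x; have [Kx|nKx] := pselect (K x); last first.
  rewrite W0// Gr0// mulr0 addr0 big1// => i _.
  by rewrite /B du0// u0// !normr0 !mul0r addr0.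
have Ox := KOm Kx; have d0 := dist_gt0 oOm pOm Ox; have dR := d_le Ox.
rewrite big_split /= -mulr_sumr addrC; apply: lerD.
  rewrite WE.
  have -> : - c * (`|u x| * hardy_weight n s gam rad (d x)) =
    `|u x| * - (c * hardy_weight n s gam rad (d x)) by ring.
  rewrite ler_wpM2l//.
  have HD := softmin_field_div_le dq lam0 q0 Y0 (xY x Ox).
  apply: (le_trans HD).
  have S0 := softmin_total_gt0 lam Y0 x.
  rewrite ler_pdivrMr// mulNr -[leLHS]opprK lerN2 -sumrN.
  under [leRHS]eq_bigr do rewrite -mulrN.
  have [y0 y0Y xy0] := Ynet x Kx.
  set kap := expR (- ((n%:R + 3 * (s - n%:R + gam) + 1) * t)) * hardy_weight n s gam rad (d x).
  have kap0 : 0 <= kap by rewrite mulr_ge0 ?expR_ge0 ?hardy_weight_ge0.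
  have ry y : y \in Y -> 0 < enorm (x - y).
    by move=> yY; rewrite enorm_gt0// subr_eq0 xY.
  apply: le_trans (softmin_concentration (kappa := kap) (rho1 := d x * expR (t / 2)) lam0 kap0 y0Y xy0 _ _).
  - apply: ler_wpM2r; first exact: ltW.
    have -> : c * hardy_weight n s gam rad (d x) = kap * (1 - t) by rewrite /c /kap; ring.
    apply: ler_wpM2l => //; rewrite lerD2l lerN2 -mulrBr -/g.
    rewrite expRN ler_pdivrMr ?expR_gt0//.
    apply: (@le_trans _ _ (t * (1 + lam * (d x * g)))); last by rewrite ler_pM2l// expR_ge1Dx.
    apply: (@le_trans _ _ (t * (lam * (m * g)))).
      by rewrite /lam le_eqVlt; apply/orP; left; apply/eqP; field; rewrite !lt0r_neq0.
    rewrite ler_pM2l// ler_wpDl// ler_wpM2l// ler_pM2r// mK//.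
  - by move=> y yY; rewrite oppr_ge0 profile_div_le0// ry.
  - move=> y yY; apply: profile_div_ge => //.
    exact: (dist_le pOm x (YOm y yY)).
have nT := softmin_field_norm_le lam q0 Y0 (xY x Ox) (a := fun i => `|du i x|)
  (B := (d x `^ (s - 1))^-1) (fun i => normr_ge0 _).
apply: le_trans (nT _) _.
  by move=> y yY; apply: profile_le => //; exact: (dist_le pOm x (YOm y yY)).
rewrite /Gr /grad_norm /enorm; under eq_bigr do rewrite real_normK ?num_real//.
by under [X in _ <= Num.sqrt X * _]eq_bigr do rewrite mxE.
Qed.


(** The limit [t -> 0] in [hardy_approx], made explicit by [(1 - t) * expR (- (N * t)) >= 1 - (N +
    1) * t]. *)
Lemma hardy_integral_le : box_integral W <= box_integral Gr.
Proof.
have [M M0 KM] := compact_box compK.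
have sW : box_supported M W by exact: supp_of.
have W_ge0 : 0 <= box_integral W.
  rewrite -(box_integral0 n); apply: (le_box_integral M0) => //; first exact: cst_continuous.
  move=> x; have [Kx|nKx] := pselect (K x); last by rewrite W0.
  by rewrite WE mulr_ge0// hardy_weight_ge0//; exact: KOm.
set N := n%:R + 3 * (s - n%:R + gam) + 1.
have N0 : 0 < N.
  rewrite ltr_wpDl// addr_ge0// mulr_ge0// addr_ge0 ?subr_ge0//.
  by rewrite ltW// (lt_trans _ gam1).
apply/ler_addgt0Pr => e e0.
(* This makes the loss [t * ((N + 1) * box_integral W)] at most [e]; the [+ 1] keeps the divisor
   positive. *)
pose t := Num.min 1 (e / ((N + 1) * box_integral W + 1)).
have D0 : 0 < (N + 1) * box_integral W + 1.
  by rewrite ltr_wpDl// mulr_ge0// addr_ge0// ltW.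
have t0 : 0 < t by rewrite lt_min ltr01 divr_gt0.
have t1 : t <= 1 by rewrite ge_min lexx.
have te : t * ((N + 1) * box_integral W + 1) <= e.
  by rewrite -ler_pdivlMr// ge_min lexx orbT.
have := hardy_approx t0 t1; rewrite -/N.
have Et : 1 - N * t <= expR (- (N * t)) by exact: expR_ge1Dx.
have : (1 - t) * (1 - N * t) * box_integral W <= (1 - t) * expR (- (N * t)) * box_integral W.
  by rewrite ler_wpM2r// ler_wpM2l// subr_ge0.
have : (1 - (N + 1) * t) * box_integral W <= (1 - t) * (1 - N * t) * box_integral W.
  rewrite ler_wpM2r// -subr_ge0.
  have -> : (1 - t) * (1 - N * t) - (1 - (N + 1) * t) = t * (N * t) by ring.
  by rewrite !mulr_ge0// ltW.
move=> H1 H2 H3; have := le_trans H1 (le_trans H2 H3).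
have -> : (1 - (N + 1) * t) * box_integral W = box_integral W - t * ((N + 1) * box_integral W) by ring.
move: te; rewrite mulrDr mulr1; lra.
Qed.

(** The integrand vanishes off [K], which lies in [Om], so the cut-off to [Om] changes nothing. *)
Let integral_on_box (f : 'rV[R]_n -> R) : continuous f -> (forall x, ~ K x -> f x = 0) ->
  integral_on Om f = (box_integral f)%:E.
Proof.
move=> cf f0; have [M M0 KM] := compact_box compK.
rewrite -(iint_box_integral M0 cf (supp_of KM f0)) /integral_on.
congr iint; apply/funext => x; case: ifPn => // /asboolPn nOx.
by rewrite f0// => /KOm.
Qed.

Lemma hardy_inequality :
  ((s - n%:R)%:E * integral_on Om (fun x => `|u x| / d x `^ s)%R
   + ((gam - 1) / rad `^ (s - n%:R))%:E
     * integral_on Om (fun x => `|u x| / d x ^+ n * Xfun (d x / rad) `^ gam)%R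
   <= integral_on Om (fun x => grad_norm u x / d x `^ (s - 1))%R)%E.
Proof.
have [M M0 KM] := compact_box compK.
rewrite (integral_on_box cV1 V10) (integral_on_box cV2 V20) (integral_on_box cGr Gr0).
rewrite -!EFinM -EFinD lee_fin; apply: le_trans hardy_integral_le.
have sV1 := supp_of KM V10; have sV2 := supp_of KM V20.
have c0 : continuous (fun _ : 'rV[R]_n => 0 : R) by exact: cst_continuous.
have s0 : box_supported M (fun _ : 'rV[R]_n => 0 : R) by [].
set k := _ / _ `^ _.
rewrite le_eqVlt; apply/orP; left; apply/eqP.
have EW : W = (fun x => (s - n%:R) * V1 x + (k * V2 x + 0)).
  by apply/funext => x; rewrite addr0.
rewrite EW (box_integral_axpy M0)//; last 2 first.
- exact: continuous_axpy.
- by move=> x j xM; rewrite (sV2 _ _ xM) mulr0 addr0.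
by rewrite (box_integral_axpy M0)// box_integral0 addr0.
Qed.
End hardy.

Unset Implicit Arguments.
Set Strict Implicit.

Theorem theorem2p5 (R : realType) (n : nat) (Om : set 'rV[R]_n)
  (Om_open : open Om) (Om_proper : Om != setT)
  (Rbdd : has_ubound [set dist_compl Om x | x in Om])
  (s gam : R) (hs : n%:R <= s) (hgam : 1 < gam) :
  let d := dist_compl Om in
  let Rad := sup [set d x | x in Om] in
  exists C : R, gam - 1 <= C /\
    forall u : 'rV[R]_n -> R, Cc_infty Om u ->
      (integral_on Om (fun x => grad_norm u x / d x `^ (s - 1))%R
       >= (s - n%:R)%:E * integral_on Om (fun x => `|u x| / d x `^ s)%R
          + (C / Rad `^ (s - n%:R))%:E
            * integral_on Om (fun x => `|u x| / d x ^+ n * Xfun (d x / Rad) `^ gam)%R)%E.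
Proof.
move=> d Rad; exists (gam - 1); split => // u hu.
(* For empty [Om], [Rad] is the default value 0 and all integrals vanish; otherwise a point of [Om]
   gives [Rad > 0]. *)
have [Om0|[x0 Ox0]] : Om = set0 \/ exists x, Om x.
  by have [->|/set0P] := eqVneq Om set0; [left|right].
  have i0 g : integral_on Om g = 0%E.
    rewrite /integral_on (_ : (fun x => _) = (fun x => 0%:E)).
      have c0 : continuous (fun _ : 'rV[R]_n => 0 : R) by exact: cst_continuous.
      by rewrite (@iint_box_integral R n 0 (fun _ => 0))// box_integral0.
    by apply/funext => x; case: ifPn => // /asboolP; rewrite Om0.
  by rewrite !i0 !mule0 adde0.
(* In dimension 0 there is a single point, so a nonempty [Om] would be the whole space. *)
have n0 : (0 < n)%N.
  rewrite lt0n; apply/eqP => n0; move/eqP: Om_proper; apply; apply/seteqP; split => // x _.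
  by subst n; rewrite (_ : x = x0)//; apply/rowP => -[].
have d_le x : Om x -> d x <= Rad.
  by move=> Ox; apply: ub_le_sup => //; exists x.
have Rad0 : 0 < Rad by apply: lt_le_trans (d_le x0 Ox0); exact: dist_gt0.
exact: hardy_inequality.
Qed.
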